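(* Let $m,n\geq 2$ be integers, let $\Omega$ be a domain in $\mathbb{R}^{m+n}=\mathbb{R}^m\times\mathbb{R}^n$, and let $K\geq 1$. Let $u:\Omega\rightarrow\mathbb{R}$ be such that (a) for each $y\in\mathbb{R}^n$ the function $\Omega(y)\ni x\mapsto u(x,y)\in\mathbb{R}$ is $K$-quasinearly subharmonic; (b) for each $x\in\mathbb{R}^m$ the function $\Omega(x)\ni y\mapsto u(x,y)\in\mathbb{R}$ is harmonic; (c) there is a nonnegative function $\varphi\in\mathcal{L}^1_{\mathrm{loc}}(\Omega)$ such that $-\varphi\leq u$. Then $u$ is $K$-quasinearly subharmonic in $\Omega$.
   Context: Points of $\mathbb{R}^{m+n}$ are written $(x,y)$ with $x\in\mathbb{R}^m$, $y\in\mathbb{R}^n$. For $y\in\mathbb{R}^n$, $\Omega(y):=\{x\in\mathbb{R}^m : (x,y)\in\Omega\}$, and for $x\in\mathbb{R}^m$, $\Omega(x):=\{y\in\mathbb{R}^n : (x,y)\in\Omega\}$; these are (possibly empty, possibly disconnected) open sets, and the conditions are vacuous for empty sections. $B^N(x,r)$ is the open ball in $\mathbb{R}^N$ with center $x$ and radius $r$, $m_N$ is Lebesgue measure on $\mathbb{R}^N$, and $\nu_N:=m_N(B^N(0,1))$. $\mathcal{L}^1_{\mathrm{loc}}(\Omega)$ is the set of locally integrable functions on $\Omega$. Definition. Let $D\subset\mathbb{R}^N$ be open, $N\geq 2$, and $K\geq 1$. A Lebesgue measurable function $u:D\to[-\infty,+\infty)$ is $K$-quasinearly subharmonic in $D$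 if $u^+:=\max\{u,0\}\in\mathcal{L}^1_{\mathrm{loc}}(D)$ and, for every $M\geq 0$ and every closed ball $\overline{B^N(x,r)}\subset D$ with $r>0$, $$u_M(x)\leq\frac{K}{\nu_N r^N}\int_{B^N(x,r)}u_M(z)\,dm_N(z),\qquad\text{where } u_M:=\max\{u,-M\}+M.$$ *)

(* Defs.v *)
From HB Require Import structures.
From mathcomp Require Import all_boot all_order all_algebra.
From mathcomp Require Import all_classical all_reals all_analysis.
From mathcomp Require Import measurable_realfun.
Import Order.TTheory GRing.Theory Num.Theory.
Import numFieldNormedType.Exports.

Set Implicit Arguments.
Unset Strict Implicit.
Unset Printing Implicit Defensive.

Local Open Scope classical_set_scope.
Local Open Scope ring_scope.

Section LebesgueOuter.
Context {R : realType} {N : nat}.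
Implicit Types A : set 'rV[R]_N.

Definition box (a b : 'rV[R]_N) : set 'rV[R]_N :=
  [set x | forall i, a 0 i < x 0 i <= b 0 i].

Definition box_volume (a b : 'rV[R]_N) : R := \prod_(i < N) (b 0 i - a 0 i).

(* The boxes of a cover are indexed by an arbitrary D `<=` nat rather than by
   nat itself: for N = 0 every box is the whole space and has volume 1, so the
   empty cover is needed to get lebesgue_outer set0 = 0. *)
Definition box_cover A (D : set nat) (a b : nat -> 'rV[R]_N) : Prop :=
  (forall k i, a k 0 i <= b k 0 i) /\
  A `<=` \bigcup_(k in D) box (a k) (b k).

Definition lebesgue_outer A : \bar R :=
  ereal_inf [set s | exists D a b, box_cover A D a b /\
    s = \esum_(k in D) (box_volume (a k) (b k))%:E]%E.

Local Open Scope ereal_scope.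

Let box_volume_ge0 (a b : nat -> 'rV[R]_N) k :
  (forall k i, a k 0%R i <= b k 0%R i)%R -> 0 <= (box_volume (a k) (b k))%:E.
Proof.
by move=> ab; rewrite lee_fin; apply: prodr_ge0 => i _; rewrite subr_ge0.
Qed.

Let lebesgue_outer_ge0 A : 0 <= lebesgue_outer A.
Proof.
apply: le_ereal_inf_tmp => _ [D [a [b [[ab _] ->]]]].
by apply: esum_ge0 => k _; exact: box_volume_ge0.
Qed.

Let lebesgue_outer0 : lebesgue_outer set0 = 0.
Proof.
apply/eqP; rewrite eq_le lebesgue_outer_ge0 andbT.
apply: ereal_inf_lbound => /=; exists set0, (fun=> 0%R), (fun=> 0%R).
by split; [split=> // k i | rewrite esum_set0].
Qed.

Let le_lebesgue_outer : {homo lebesgue_outer : A B / A `<=` B >-> A <= B}.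
Proof.
move=> A B AB; apply/ereal_inf_le_tmp => x [D [a [b [[ab Bc] ->]]]].
by exists D, a, b; split=> //; split=> //; exact: subset_trans AB Bc.
Qed.

Let lebesgue_outer_sigma_subadditive : sigma_subadditive lebesgue_outer.
Proof.
move=> A; have [[i ioo]|] := pselect (exists i, lebesgue_outer (A i) = +oo).
  rewrite (eseries_pinfty _ _ ioo) ?leey// => n _.
  by rewrite -ltNye (lt_le_trans _ (lebesgue_outer_ge0 _)).
rewrite -forallNE => Aoo.
suff add2e (e : {posnum R}) : lebesgue_outer (\bigcup_n A n) <=
    \sum_(i <oo) lebesgue_outer (A i) + e%:num%:E.
  by apply/lee_addgt0Pr => _/posnumP[].
rewrite (le_trans _ (epsilon_trick _ _ _))//.
pose P n (c : set nat * (nat -> 'rV[R]_N) * (nat -> 'rV[R]_N)) :=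
  box_cover (A n) c.1.1 c.1.2 c.2 /\
  \esum_(k in c.1.1) (box_volume (c.1.2 k) (c.2 k))%:E <=
    lebesgue_outer (A n) + (e%:num / (2 ^ n.+1)%:R)%:E.
have [G PG] : {G & forall n, P n (G n)}.
  apply: (@choice _ _ P) => n.
  have en1 : (0 < e%:num / (2 ^ n.+1)%:R)%R by [].
  have fA : lebesgue_outer (A n) \is a fin_num.
    by rewrite ge0_fin_numE// ltey; apply/eqP; exact: Aoo.
  have [_ [D [a [b [cab ->]]]] lt_ab] := lb_ereal_inf_adherent en1 fA.
  by exists (D, a, b); split => //; exact: ltW.
pose v (p : nat * nat) := (box_volume ((G p.1).1.2 p.2) ((G p.1).2 p.2))%:E.
have v_ge0 p : 0 <= v p.
  exact: (@box_volume_ge0 (fun k => (G p.1).1.2 k) _ _ (PG p.1).1.1).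
pose J n : set (nat * nat) := [set (n, k) | k in (G n).1.1].
apply: (@le_trans _ _ (\esum_(p in \bigcup_n J n) v p)).
  have /card_esym/ppcard_eqP[f] := card_nat2.
  apply: ereal_inf_lbound => /=.
  exists [set k | (\bigcup_n J n) (f k)],
    (fun k => (G (f k).1).1.2 (f k).2), (fun k => (G (f k).1).2 (f k).2).
  split.
    split=> [k i|t [n _ Ant]]; first exact: (PG _).1.1.
    have [k Dk tk] := (PG n).1.2 _ Ant.
    exists (f^-1%FUN (n, k)); rewrite /= invK ?inE//.
    by exists n => //; exists k.
  apply: (reindex_esum _ _ (f : nat -> nat * nat)) => //; split => //.
  - by move=> x y _ _; apply: inj; rewrite inE.
  - move=> p Jp; exists (f^-1%FUN p); rewrite /= invK ?inE//.
rewrite esum_bigcupT//; last first.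
  apply/trivIsetP => i j _ _ ij; rewrite predeqE => -[n m]; split => //=.
  by move=> [[? _ [ni _]] [? _ [nj _]]]; move: ij; rewrite ni nj eqxx.
rewrite -nneseries_esumT//; last by move=> n; exact: esum_ge0.
apply: lee_nneseries => n _; first by move=> _; exact: esum_ge0.
rewrite (le_trans _ (PG n).2)// le_eqVlt; apply/orP; left; apply/eqP.
rewrite /J esum_image//.
by move=> x y _ _ [].
Qed.

HB.instance Definition _ := isOuterMeasure.Build R 'rV[R]_N lebesgue_outer
  lebesgue_outer0 lebesgue_outer_ge0 le_lebesgue_outer
  lebesgue_outer_sigma_subadditive.

End LebesgueOuter.

(* N-dimensional Lebesgue measure on the Lebesgue-measurable sets (those
   that are Caratheodory-measurable for lebesgue_outer, so that the measure is
   complete). The carrier of lebesgue_space R N is convertible to 'rV[R]_N. *)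
Definition lebesgue_space (R : realType) (N : nat) : measurableType _ :=
  caratheodory_type (@lebesgue_outer R N).

Definition lebesgue_measure_rV (R : realType) (N : nat) :
  set (lebesgue_space R N) -> \bar R := @lebesgue_outer R N.

Arguments lebesgue_measure_rV R N : clear implicits.

HB.instance Definition _ (R : realType) (N : nat) :=
  isMeasure.Build _ (lebesgue_space R N) R (lebesgue_measure_rV R N)
    (@caratheodory_measure0 R 'rV[R]_N (@lebesgue_outer R N))
    (@caratheodory_measure_ge0 R 'rV[R]_N (@lebesgue_outer R N))
    (@caratheodory_measure_sigma_additive R 'rV[R]_N (@lebesgue_outer R N)).

(* The library norm of 'rV[R]_N is the sup norm; it induces the same topology
   but not the same balls. *)
Definition euclidean_norm (R : realType) (N : nat) (v : 'rV[R]_N) : R :=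
  Num.sqrt (\sum_(i < N) v 0 i ^+ 2).

Definition euclidean_ball (R : realType) (N : nat) (x : 'rV[R]_N) (r : R) :
  set 'rV[R]_N := [set z | euclidean_norm (z - x) < r].

Definition closed_euclidean_ball (R : realType) (N : nat) (x : 'rV[R]_N)
  (r : R) : set 'rV[R]_N := [set z | euclidean_norm (z - x) <= r].

Definition unit_ball_volume (R : realType) (N : nat) : R :=
  fine (lebesgue_measure_rV R N (euclidean_ball 0 1)).

Definition domain (R : realType) (N : nat) (D : set 'rV[R]_N) : Prop :=
  [/\ open D, connected D & D !=set0].

Definition lebesgue_measurable_fun (R : realType) (N : nat)
    (D : set 'rV[R]_N) (f : 'rV[R]_N -> \bar R) : Prop :=
  measurable_fun (D : set (lebesgue_space R N))
    (f : lebesgue_space R N -> \bar R).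

(* Functions on D are represented by total functions; only the values on D are
   relevant here and in the definitions below (D being open). *)
Definition L1loc (R : realType) (N : nat) (D : set 'rV[R]_N)
    (f : 'rV[R]_N -> \bar R) : Prop :=
  lebesgue_measurable_fun D f /\
  forall C : set 'rV[R]_N, compact C -> C `<=` D ->
    (\int[lebesgue_measure_rV R N]_(z in C) `|f z| < +oo)%E.

Definition truncation (R : realType) (T : Type) (u : T -> \bar R) (M : R) :
  T -> \bar R := fun z => (maxe (u z) (- M)%:E + M%:E)%E.

(* Meant for D open, 2 <= N and 1 <= K. *)
Definition quasinearly_subharmonic (R : realType) (N : nat) (K : R)
    (D : set 'rV[R]_N) (u : 'rV[R]_N -> \bar R) : Prop :=
  [/\ forall x, D x -> (u x < +oo)%E,
      lebesgue_measurable_fun D u,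
      L1loc D (u^\+)%E
    & forall (M : R) (x : 'rV[R]_N) (r : R),
        0 <= M -> 0 < r -> closed_euclidean_ball x r `<=` D ->
        (truncation u M x <=
         (K / (unit_ball_volume R N * r ^+ N))%:E *
         \int[lebesgue_measure_rV R N]_(z in euclidean_ball x r)
           truncation u M z)%E].

Definition partial (R : realType) (N : nat) (i : 'I_N) (f : 'rV[R]_N -> R) :
  'rV[R]_N -> R := 'D_(delta_mx 0 i) f.

Definition C2_on (R : realType) (N : nat) (D : set 'rV[R]_N)
    (f : 'rV[R]_N -> R) : Prop :=
  forall x, D x ->
    [/\ {for x, continuous f},
        forall i, derivable f x (delta_mx 0 i),
        forall i, {for x, continuous (partial i f)},
        forall i j, derivable (partial i f) x (delta_mx 0 j)
      & forall i j, {for x, continuous (partial j (partial i f))}].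

Definition laplacian (R : realType) (N : nat) (f : 'rV[R]_N -> R) :
  'rV[R]_N -> R := fun x => \sum_(i < N) partial i (partial i f) x.

Definition harmonic_on (R : realType) (N : nat) (D : set 'rV[R]_N)
    (f : 'rV[R]_N -> R) : Prop :=
  C2_on D f /\ forall x, D x -> laplacian f x = 0.

(* Points of R^(m+n) are written row_mx x y. *)
Definition x_section (R : realType) (m n : nat) (Omega : set 'rV[R]_(m + n))
  (y : 'rV[R]_n) : set 'rV[R]_m := [set x | Omega (row_mx x y)].

Definition y_section (R : realType) (m n : nat) (Omega : set 'rV[R]_(m + n))
  (x : 'rV[R]_m) : set 'rV[R]_n := [set y | Omega (row_mx x y)].

(* Main.v *)
(* For the mean inequality on a ball B of center (x0, y0), Tonelli reduces the
   integral of u_M over B to its slices. Each slice in y is a ball centered at y0,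
   on which the harmonic function u(x, .) has the mean value property, so u_M(x, y)
   may be replaced by the smaller u_M(x, y0); slicing B the other way, in balls
   centered at x0, hypothesis (a) replaces u_M(x, y0) by u_M(x0, y0) / K.

   For local integrability of u^+, the mean value property on B^n(y0, r) bounds
   the integral of u^+(x, .) by m(B^n(y0, r)) u^+(x, y0) plus the integral of
   u^-(x, .), and u^- <= phi; then integrate in x.

   Spheres are avoided in the mean value property: the divergence identity is
   applied to compactly supported fields, for which it only expresses the
   translation invariance of Lebesgue measure. *)

From HB Require Import structures.
Require Import Defs.
From mathcomp Require Import all_boot all_order all_algebra.
From mathcomp Require Import all_classical all_reals all_analysis.
From mathcomp Require Import measurable_realfun.
From mathcomp Require Import ring lra.
Import Order.TTheory GRing.Theory Num.Theory.
Import numFieldNormedType.Exports.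

Set Implicit Arguments.
Unset Strict Implicit.
Unset Printing Implicit Defensive.

Local Open Scope classical_set_scope.
Local Open Scope ring_scope.

(** Sets measurable in [lebesgue_space] are those of a complete measure, so an individual slice of
    such a set need not be measurable. Tonelli is therefore applied to functions that are measurable
    for the product of the two factor spaces. The function [u] is of this kind because it is
    measurable in [x] and continuous in [y]; Lebesgue measurability in dimension [m + n] follows by
    pulling back along [row_split].

    In the mean inequality the harmonic variable has constant 1 in its mean value property, so
    replacing values by their centers in both variables costs the factor [K] once. All functions
    there are nonnegative, so the integrals may be infinite.

    Local integrability has a different obstacle: the mean value property gives the signed integral
    of each [u(x, .)], with no uniformity in [x] for the negative part. The function [phi] supplies
    a bound of that part which can be integrated in [x]. *)

Local Notation lam R N := (lebesgue_measure_rV R N).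

(** * Boxes and Lebesgue outer measure *)

Lemma lebesgue_outer_box_le (R : realType) (N : nat) (a b : 'rV[R]_N) :
  (forall i, a 0 i <= b 0 i) ->
  (lebesgue_outer (box a b) <= (box_volume a b)%:E)%E.
Proof.
move=> ab; apply: ereal_inf_lbound => /=.
exists [set 0%N], (fun=> a), (fun=> b); split.
  by split=> // x xab; exists 0%N.
by rewrite esum_set1// lee_fin prodr_ge0// => i _; rewrite subr_ge0.
Qed.

Lemma box_volume_ge0 (R : realType) (N : nat) (a b : 'rV[R]_N) :
  (forall i, a 0 i <= b 0 i) -> 0 <= box_volume a b.
Proof. by move=> ab; apply: prodr_ge0 => i _; rewrite subr_ge0. Qed.

Lemma outer_measure_le_esum (R : realType) (T : Type)
    (mu : {outer_measure set T -> \bar R}) (D : set nat) (A : set T)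
    (F : nat -> set T) :
  A `<=` \bigcup_(k in D) F k -> (mu A <= \esum_(k in D) mu (F k))%E.
Proof.
move=> AF; pose G k := if k \in D then F k else set0.
apply: (@le_trans _ _ (mu (\bigcup_k G k))).
  apply: le_outer_measure => x /AF[k Dk Fkx]; exists k => //.
  by rewrite /G mem_set.
apply: le_trans (outer_measure_sigma_subadditive mu G) _.
rewrite nneseries_esumT//; last by move=> n; exact: outer_measure_ge0.
rewrite [leRHS]esum_mkcond; apply: le_esum => i _; rewrite /G.
by case: ifPn => // _; rewrite outer_measure0.
Qed.

Lemma esumZl (R : realType) (D : set nat) (c : R) (f : nat -> \bar R) :
  (0 <= c)%R -> (forall k, (0 <= f k)%E) ->
  \esum_(k in D) (c%:E * f k)%E = (c%:E * \esum_(k in D) f k)%E.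
Proof.
move=> c0 f0.
have <- : [set k | k \in D] = D by apply/seteqP; split=> k /=; rewrite in_setE.
rewrite -!nneseries_esum//.
  by rewrite nneseriesZl.
by move=> k _; rewrite mule_ge0// lee_fin.
Qed.

Definition set_coord (R : realType) (N : nat) (v : 'rV[R]_N) (i : 'I_N) (c : R)
  : 'rV[R]_N := \row_j (if j == i then c else v 0 j).

Lemma box_volume_split (R : realType) (N : nat) (a b : 'rV[R]_N) (i : 'I_N)
    (c : R) :
  box_volume a (set_coord b i c) + box_volume (set_coord a i c) b =
  box_volume a b.
Proof.
rewrite /box_volume (bigD1 i)//= [X in _ + X](bigD1 i)//= [RHS](bigD1 i)//=.
rewrite !mxE eqxx.
under eq_bigr => j /negbTE ji do rewrite mxE ji.
under [X in _ + _ * X]eq_bigr => j /negbTE ji do rewrite mxE ji.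
by rewrite -mulrDl; congr (_ * _); ring.
Qed.

(** The hyperplane cuts each box of a cover of [X] into two boxes whose volumes add up. The two
    families cover the two pieces of [X] at the same total cost, which is the Caratheodory
    inequality. *)
Lemma lebesgue_measurable_halfspace (R : realType) (N : nat) (i : 'I_N)
    (c : R) :
  measurable ([set x | x 0 i <= c] : set (lebesgue_space R N)).
Proof.
apply: le_caratheodory_measurable => X.
apply: le_ereal_inf_tmp => _ [D [a [b [[ab XD] ->]]]].
(* This is [c] clamped to the edge of the box: when the hyperplane misses the box, one half is
   degenerate and has volume 0. *)
pose p k := Num.max (a k 0 i) (Num.min (b k 0 i) c).
have pa k : a k 0 i <= p k by rewrite /p le_max lexx.
have pb k : p k <= b k 0 i by rewrite /p ge_max ab ge_min lexx.
pose F k := box (a k) (set_coord (b k) i (p k)).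
pose G k := box (set_coord (a k) i (p k)) (b k).
have Fab k j : a k 0 j <= set_coord (b k) i (p k) 0 j.
  by rewrite mxE; case: eqP => // ->.
have Gab k j : set_coord (a k) i (p k) 0 j <= b k 0 j.
  by rewrite mxE; case: eqP => // ->.
apply: (@le_trans _ _ (\esum_(k in D) lebesgue_outer (F k) +
   \esum_(k in D) lebesgue_outer (G k))%E).
  apply: leeD; apply: outer_measure_le_esum => x [Xx /=].
    move=> xc; have [k Dk xk] := XD _ Xx; exists k => // j.
    rewrite mxE; case: eqP => [->|_]; last exact: xk.
    by have /andP[-> ?] := xk i; rewrite /p le_max le_min xc andbT; lra.
  move=> /negP; rewrite -ltNge => xc; have [k Dk xk] := XD _ Xx; exists k => // j.
  rewrite mxE; case: eqP => [->|_]; last exact: xk.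
  by have /andP[? ->] := xk i; rewrite /p gt_max gt_min xc orbT andbT; lra.
rewrite -esumD; try by move=> ? _; exact: outer_measure_ge0.
apply: le_esum => k _.
rewrite -(box_volume_split (a k) (b k) i (p k)) EFinD.
by apply: leeD; exact: lebesgue_outer_box_le.
Qed.

Lemma lebesgue_measurable_box (R : realType) (N : nat) (a b : 'rV[R]_N) :
  measurable (box a b : set (lebesgue_space R N)).
Proof.
rewrite (_ : box a b = \bigcap_(i in [set: 'I_N])
    (~` [set x | x 0 i <= a 0 i] `&` [set x | x 0 i <= b 0 i])); last first.
  apply/seteqP; split=> x /= xab.
    move=> i _; have /andP[ax xb] := xab i; split=> //=.
    by apply/negP; rewrite -ltNge.
  by move=> i; have [/= /negP] := xab i I; rewrite -ltNge => -> ->.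
apply: (@fin_bigcap_measurable _ (lebesgue_space R N) _ setT
  (fun i => ~` [set x : 'rV_N | x 0 i <= a 0 i] `&`
            [set x : 'rV_N | x 0 i <= b 0 i])) => // i _.
apply: measurableI; last exact: lebesgue_measurable_halfspace.
by apply: measurableC; exact: lebesgue_measurable_halfspace.
Qed.

(** Rational corners make the union countable. This serves measurability of open sets, both in one
    space and in a product, and the density of rational rows. *)
Lemma open_rat_boxes (R : realType) (N : nat) (U : set 'rV[R]_N) : open U ->
  U = \bigcup_(pq in [set pq : 'rV[rat]_N * 'rV[rat]_N |
       box (map_mx ratr pq.1) (map_mx ratr pq.2) `<=` U])
       box (map_mx ratr pq.1) (map_mx ratr pq.2).
Proof.
move=> oU; apply/seteqP; split=> [x Ux|x [pq /= pqU xpq]]; last exact: pqU.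
have /nbhs_ballP[e /= e0 xeU] := open_nbhs_nbhs (conj oU Ux).
have /choice[p pP] : forall i : 'I_N, exists q : rat, ratr q \in `]x 0 i - e, x 0 i[.
  by move=> i; apply: rat_in_itvoo; lra.
have /choice[q qP] : forall i : 'I_N, exists q : rat, ratr q \in `]x 0 i, x 0 i + e[.
  by move=> i; apply: rat_in_itvoo; lra.
exists (\row_i p i, \row_i q i) => /=.
  move=> z zpq; apply: xeU; split=> // i j; rewrite (ord1 i) /ball /=.
  have := zpq j; rewrite !mxE => /andP[h1 h2].
  have := pP j; have := qP j; rewrite !in_itv /= => /andP[h3 h4] /andP[h5 h6].
  by rewrite ltr_norml; apply/andP; split; lra.
move=> i; rewrite !mxE.
have := pP i; have := qP i; rewrite !in_itv /= => /andP[h3 h4] /andP[h5 h6].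
by apply/andP; split; lra.
Qed.

Lemma lebesgue_measurable_open (R : realType) (N : nat) (U : set 'rV[R]_N) :
  open U -> measurable (U : set (lebesgue_space R N)).
Proof.
move=> oU; rewrite (open_rat_boxes oU) bigcup_mkcond.
apply: (@countable_bigcupT_measurable _ (lebesgue_space R N)).
  exact: countableP.
move=> pq; case: ifP => _; last exact: measurable0.
exact: lebesgue_measurable_box.
Qed.

Lemma lebesgue_measure_itvoc (R : realType) (a b : R) : a <= b ->
  lebesgue_measure (`]a, b]%classic : set R) = (b - a)%:E.
Proof.
move=> ab; rewrite lebesgue_measure_itv /= lte_fin.
case: ltP => [_|ba]; first by rewrite -EFinB.
by have /eqP -> : a == b; [rewrite eq_le ab|rewrite subrr].
Qed.

Definition row_tail (R : realType) (N : nat) (v : 'rV[R]_N.+1) : 'rV[R]_N :=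
  \row_i v 0 (lift ord0 i).

Lemma box_volume_recl (R : realType) (N : nat) (a b : 'rV[R]_N.+1) :
  box_volume a b =
  (b 0 ord0 - a 0 ord0) * box_volume (row_tail a) (row_tail b).
Proof.
rewrite /box_volume big_ord_recl; congr (_ * _).
by apply: eq_bigr => i _; rewrite !mxE.
Qed.

(* Induction on the dimension: for fixed first coordinate [x] the slices of the
   boxes containing [x] cover the slice of [box a b]; integrate over [x]. *)
Lemma box_volume_le_cover (R : realType) (N : nat) (a b : 'rV[R]_N)
    (D : set nat) (a' b' : nat -> 'rV[R]_N) :
  (forall i, a 0 i <= b 0 i) -> box_cover (box a b) D a' b' ->
  ((box_volume a b)%:E <= \esum_(k in D) (box_volume (a' k) (b' k))%:E)%E.
Proof.
elim: N a b a' b' D => [|N IHN] a b a' b' D ab [ab' cov].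
  (* In dimension 0 every box is the whole space and has volume 1, so it is enough that the cover
     contains one box. *)
  have [k Dk _] : (\bigcup_(k in D) box (a' k) (b' k)) a by apply: cov => -[].
  apply: esum_ge; exists [set k]; first by split=> // j /= ->.
  by rewrite fsbig_set1 /box_volume !big_ord0.
have tail_ge0 k : 0 <= box_volume (row_tail (a' k)) (row_tail (b' k)).
  by apply: box_volume_ge0 => i; rewrite !mxE.
pose I k : set R := `]a' k 0 ord0, b' k 0 ord0]%classic.
pose f k (x : R) :=
  ((\1_(I k) x)%:E * (box_volume (row_tail (a' k)) (row_tail (b' k)))%:E)%E.
have f0 k x : (0 <= f k x)%E by rewrite mule_ge0 ?lee_fin.
have mf k : measurable_fun setT (f k).
  apply: emeasurable_funM => //; apply/measurable_EFinP.
  by apply: measurable_indic; exact: measurable_itv.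
have DE : [set k | k \in D] = D by apply/seteqP; split=> k /=; rewrite in_setE.
pose J : set R := `]a 0 ord0, b 0 ord0]%classic.
have slice x : J x ->
    ((box_volume (row_tail a) (row_tail b))%:E <=
     \big[+%E/0%E]_(0 <= k <oo | k \in D) f k x)%E.
  move=> Jx; rewrite nneseries_esum// DE.
  rewrite (_ : esum _ _ = \esum_(k in D `&` [set k | I k x])
     (box_volume (row_tail (a' k)) (row_tail (b' k)))%:E)%E; last first.
    rewrite esum_mkcondr; apply: eq_esum => k Dk.
    rewrite /f indicE; case: ifPn => xI.
      by rewrite mem_set ?mul1e//; exact: set_mem xI.
    rewrite memNset ?mul0e//; exact: (negP xI \o mem_set).
  apply: IHN; first by move=> i; rewrite !mxE.
  split=> [k i|y yab]; first by rewrite !mxE.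
  pose z : 'rV[R]_N.+1 := \row_i oapp (fun j => y 0 j) x (unlift ord0 i).
  have [|k Dk zk] := cov z.
    move=> i; rewrite mxE; case: (unliftP ord0 i) => [j ->|->] /=.
      by have := yab j; rewrite !mxE.
    by move: Jx; rewrite /J /= in_itv.
  exists k.
    split=> //=; have := zk ord0; rewrite mxE unlift_none /=.
    by rewrite /I /= in_itv.
  by move=> i; have := zk (lift ord0 i); rewrite !mxE liftK /=.
have intJ : (\int[lebesgue_measure]_(x in J)
    (box_volume (row_tail a) (row_tail b))%:E = (box_volume a b)%:E)%E.
  rewrite integral_cst; last exact: measurable_itv.
  rewrite [X in (_ * X)%E](_ : _ = (b 0 ord0 - a 0 ord0)%:E); last first.
    exact: lebesgue_measure_itvoc.
  by rewrite box_volume_recl -EFinM mulrC.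
rewrite -intJ -DE -nneseries_esum; last first.
  by move=> k _; rewrite lee_fin; exact: box_volume_ge0.
apply: (@le_trans _ _ (\int[lebesgue_measure]_(x in J)
    \big[+%E/0%E]_(0 <= k <oo | k \in D) f k x)%E).
  apply: ge0_le_integral => //=.
  - exact: measurable_itv.
  - by move=> x _; rewrite lee_fin box_volume_ge0// => i; rewrite !mxE.
  - by apply: ge0_emeasurable_sum => // k _; apply: measurable_funTS; exact: mf.
have -> : (fun x => \big[+%E/0%E]_(0 <= k <oo | k \in D) f k x)%E =
   (fun x => \big[+%E/0%E]_(0 <= k <oo) (if k \in D then f k x else 0%E))%E.
  by apply/funext => x; rewrite eseries_mkcond.
rewrite integral_nneseries; last 3 first.
- exact: measurable_itv.
- by move=> k; case: (k \in D) => //; apply: measurable_funTS; exact: mf.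
- by move=> k x _; case: (k \in D).
rewrite [leRHS]eseries_mkcond; apply: lee_nneseries => k _.
  by move=> _; apply: integral_ge0 => x _; case: (k \in D).
case: (k \in D); last by rewrite integral0.
apply: (@le_trans _ _ (\int[lebesgue_measure]_x f k x)%E).
  apply: ge0_subset_integral => //; [exact: measurable_itv|exact: mf].
rewrite /f ge0_integralZr//; last 2 first.
  apply/measurable_EFinP; apply: measurable_indic; exact: measurable_itv.
  by rewrite lee_fin.
rewrite integral_indic//; last exact: measurable_itv.
rewrite setIT [X in (X * _)%E](_ : _ = (b' k 0 ord0 - a' k 0 ord0)%:E).
  by rewrite box_volume_recl EFinM.
exact: lebesgue_measure_itvoc.
Qed.

Lemma lebesgue_outer_box (R : realType) (N : nat) (a b : 'rV[R]_N) :
  (forall i, a 0 i <= b 0 i) ->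
  lebesgue_outer (box a b) = (box_volume a b)%:E.
Proof.
move=> ab; apply/eqP; rewrite eq_le lebesgue_outer_box_le//=.
apply: le_ereal_inf_tmp => _ [D [a' [b' [cov ->]]]].
exact: box_volume_le_cover.
Qed.

(** * Dilations, balls and cubes *)

(** The inverse affine map sends boxes to boxes and divides volumes by [c ^+ N], so every cover of
    [A] is transported. One inequality suffices: applied to the inverse dilation it yields the
    other. *)
Lemma lebesgue_outer_affine_le (R : realType) (N : nat) (v : 'rV[R]_N) (c : R)
    (A : set 'rV[R]_N) : 0 < c ->
  ((c ^+ N)%:E * lebesgue_outer [set x | A (v + c *: x)%R] <= lebesgue_outer A)%E.
Proof.
move=> c0; have cN0 : 0 < c ^+ N by rewrite exprn_gt0.
apply: le_ereal_inf_tmp => _ [D [a [b [[ab AD] ->]]]].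
rewrite -lee_pdivlMl//.
have pre k j : ((c^-1 *: (a k - v)) 0 j <= (c^-1 *: (b k - v)) 0 j)%R.
  by rewrite !mxE ler_pM2l ?invr_gt0// lerD2r.
apply: (@le_trans _ _ (\esum_(k in D)
   lebesgue_outer (box (c^-1 *: (a k - v)) (c^-1 *: (b k - v))))%E).
  apply: outer_measure_le_esum => x /= /AD[k Dk xk]; exists k => // j.
  have := xk j; rewrite !mxE => /andP[? ?].
  by rewrite mulrC ltr_pdivrMr// mulrC ler_pdivlMl//; apply/andP; split; lra.
rewrite -esumZl; last 2 first.
- by rewrite invr_ge0 ltW.
- by move=> k; rewrite lee_fin; exact: box_volume_ge0.
apply: le_esum => k _; rewrite lebesgue_outer_box// -EFinM lee_fin.
rewrite /box_volume -exprVn -[X in c^-1 ^+ X](card_ord N).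
rewrite -prodr_const -big_split /=.
by rewrite le_eqVlt; apply/orP; left; apply/eqP/eq_bigr => i _; rewrite !mxE; ring.
Qed.

Lemma lebesgue_outer_affine (R : realType) (N : nat) (v : 'rV[R]_N) (c : R)
    (A : set 'rV[R]_N) : 0 < c ->
  lebesgue_outer A =
  ((c ^+ N)%:E * lebesgue_outer [set x | A (v + c *: x)%R])%E.
Proof.
move=> c0; apply/eqP; rewrite eq_le lebesgue_outer_affine_le// andbT.
have cV0 : 0 < c^-1 by rewrite invr_gt0.
have := lebesgue_outer_affine_le (- (c^-1 *: v)) [set x | A (v + c *: x)] cV0.
rewrite /= (_ : [set x | _] = A).
  by rewrite exprVn lee_pdivrMl// exprn_gt0.
apply/seteqP; split => x /=;
by rewrite scalerDr scalerN !scalerA divff ?gt_eqF// !scale1r addrA subrr add0r.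
Qed.

Lemma lebesgue_outer_translate (R : realType) (N : nat) (v : 'rV[R]_N)
    (A : set 'rV[R]_N) :
  lebesgue_outer [set x | A (v + x)] = lebesgue_outer A.
Proof.
rewrite (lebesgue_outer_affine v A ltr01) expr1n mul1e; congr lebesgue_outer.
by apply/seteqP; split => x /=; rewrite scale1r.
Qed.

(** Translation invariance turns the splitting of [X] by the preimage of [A] into the splitting of a
    translate of [X] by [A] itself. *)
Lemma measurable_translation (R : realType) (N : nat) (v : 'rV[R]_N) :
  measurable_fun setT
    ((fun x => v + x) : lebesgue_space R N -> lebesgue_space R N).
Proof.
move=> _ A mA; rewrite setTI; apply: le_caratheodory_measurable => X.
change (lebesgue_outer (X `&` [set x | A (v + x)%R]) +
  lebesgue_outer (X `&` ~` [set x | A (v + x)%R]) <= lebesgue_outer X)%E.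
rewrite -(lebesgue_outer_translate (- v) X).
rewrite -(lebesgue_outer_translate (- v) (X `&` _)).
rewrite -(lebesgue_outer_translate (- v) (X `&` ~` _)).
rewrite [leRHS](mA [set x | X (- v + x)%R]).
by apply: leeD; apply: le_outer_measure => x /=; rewrite addrA subrr add0r.
Qed.

(** Preferred to the norm because it is a polynomial, differentiable everywhere, and is additive
    over [row_mx], so that slices of balls are balls. *)
Definition sqnorm (R : realType) (N : nat) (v : 'rV[R]_N) : R :=
  \sum_(i < N) v 0 i ^+ 2.

Lemma sqnorm_ge0 (R : realType) (N : nat) (v : 'rV[R]_N) : 0 <= sqnorm v.
Proof. by apply: sumr_ge0 => i _; exact: sqr_ge0. Qed.

Lemma sqr_coord_le (R : realType) (N : nat) (v : 'rV[R]_N) i :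
  v 0 i ^+ 2 <= sqnorm v.
Proof.
by rewrite /sqnorm (bigD1 i)//= lerDl sumr_ge0// => j _; exact: sqr_ge0.
Qed.

Lemma euclidean_ballE (R : realType) (N : nat) (x : 'rV[R]_N) (r : R) :
  0 < r -> euclidean_ball x r = [set z | sqnorm (z - x) < r ^+ 2].
Proof.
move=> r0; apply/funext => z; apply/propext; rewrite /euclidean_ball /=.
rewrite /euclidean_norm -[X in _ < X <-> _](ger0_norm (ltW r0)) -sqrtr_sqr.
by rewrite ltr_sqrt ?exprn_gt0.
Qed.

Lemma closed_euclidean_ballE (R : realType) (N : nat) (x : 'rV[R]_N) (r : R) :
  0 < r -> closed_euclidean_ball x r = [set z | sqnorm (z - x) <= r ^+ 2].
Proof.
move=> r0; apply/funext => z; apply/propext; rewrite /closed_euclidean_ball /=.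
rewrite /euclidean_norm -[X in _ <= X <-> _](ger0_norm (ltW r0)) -sqrtr_sqr.
by rewrite ler_sqrt ?sqr_ge0.
Qed.

Lemma continuous_sum_at (R : realType) (T : topologicalType) (I : Type)
    (s : seq I) (f : I -> T -> R) (x : T) :
  (forall i, {for x, continuous (f i)}) ->
  {for x, continuous (fun z => \sum_(i <- s) f i z)}.
Proof.
move=> cf; elim: s => [|i s IHs].
  rewrite (_ : (fun z => _) = cst 0); first exact: cst_continuous.
  by apply/funext => z; rewrite big_nil.
rewrite (_ : (fun z => _) = (fun z => f i z + \sum_(i <- s) f i z)); last first.
  by apply/funext => z; rewrite big_cons.
by apply: continuousD; [exact: cf|exact: IHs].
Qed.

Lemma continuous_exp_at (R : realType) (T : topologicalType) (f : T -> R)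
    (x : T) (n : nat) :
  {for x, continuous f} -> {for x, continuous (fun z => f z ^+ n)}.
Proof.
move=> cf; elim: n => [|n IHn].
  rewrite (_ : (fun z => _) = cst 1); first exact: cst_continuous.
  by apply/funext => z; rewrite expr0.
rewrite (_ : (fun z => _) = (fun z => f z * f z ^+ n)); last first.
  by apply/funext => z; rewrite exprS.
exact: continuousM.
Qed.

Lemma continuous_coordB (R : realType) (N : nat) (x0 : 'rV[R]_N) (i : 'I_N) :
  continuous (fun z : 'rV[R]_N => (z - x0) 0 i).
Proof.
move=> z; rewrite (_ : (fun z => _) = (fun z : 'rV[R]_N => z 0 i - x0 0 i)).
  by apply: continuousB; [exact: coord_continuous|exact: cst_continuous].
by apply/funext => w; rewrite !mxE.
Qed.

Lemma continuous_sqnormB (R : realType) (N : nat) (x : 'rV[R]_N) :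
  continuous (fun z : 'rV[R]_N => sqnorm (z - x)).
Proof.
move=> z; apply: continuous_sum_at => i; apply: continuous_exp_at.
exact: continuous_coordB.
Qed.

Lemma open_sqnorm_lt (R : realType) (N : nat) (x : 'rV[R]_N) (t : R) :
  open [set z | sqnorm (z - x) < t].
Proof.
rewrite (_ : [set z | _] = (fun z => sqnorm (z - x)) @^-1` [set y | y < t])//.
apply: open_comp; last exact: open_lt.
by move=> z _; exact: continuous_sqnormB.
Qed.

Lemma closed_sqnorm_le (R : realType) (N : nat) (x : 'rV[R]_N) (t : R) :
  closed [set z | sqnorm (z - x) <= t].
Proof.
rewrite (_ : [set z | _] = (fun z => sqnorm (z - x)) @^-1` [set y | y <= t])//.
apply: preimage_closed; last exact: closed_le.
by move=> z _; exact: continuous_sqnormB.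
Qed.

Lemma open_euclidean_ball (R : realType) (N : nat) (x : 'rV[R]_N) (r : R) :
  0 < r -> open (euclidean_ball x r).
Proof. by move=> r0; rewrite euclidean_ballE//; exact: open_sqnorm_lt. Qed.

Lemma sqnorm_le_coord (R : realType) (N : nat) (v : 'rV[R]_N) (r : R) i :
  0 <= r -> sqnorm v <= r ^+ 2 -> `|v 0 i| <= r.
Proof.
move=> r0 vr; rewrite -[r]ger0_norm// -ler_sqr ?nnegrE// !real_normK ?num_real//.
exact: le_trans (sqr_coord_le v i) vr.
Qed.

Lemma compact_closed_euclidean_ball (R : realType) (N : nat) (x : 'rV[R]_N)
    (r : R) : 0 < r -> compact (closed_euclidean_ball x r).
Proof.
move=> r0; apply: bounded_closed_compact.
  exists (`|x| + r); split; first exact: num_real.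
  move=> M xrM z; rewrite closed_euclidean_ballE// => zr.
  have zx : `|z - x| <= r.
    rewrite [leLHS]mx_normrE; apply: bigmax_le => [|i _]; first exact: ltW.
    by rewrite (ord1 i.1); apply: sqnorm_le_coord => //; exact: ltW.
  rewrite -(subrK x z); apply: le_trans (ler_normD _ _) _; lra.
by rewrite closed_euclidean_ballE//; exact: closed_sqnorm_le.
Qed.

Lemma lebesgue_measurable_closed (R : realType) (N : nat) (C : set 'rV[R]_N) :
  closed C -> measurable (C : set (lebesgue_space R N)).
Proof.
move=> cC; rewrite -[X in measurable X]setCK.
by apply: measurableC; apply: lebesgue_measurable_open; exact: closed_openC.
Qed.

Lemma closed_euclidean_ball_measurable (R : realType) (N : nat) (x : 'rV[R]_N)
    (r : R) : 0 < r ->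
  measurable (closed_euclidean_ball x r : set (lebesgue_space R N)).
Proof.
move=> r0; apply: lebesgue_measurable_closed.
by rewrite closed_euclidean_ballE//; exact: closed_sqnorm_le.
Qed.

Lemma euclidean_ball_measurable (R : realType) (N : nat) (x : 'rV[R]_N)
    (r : R) : 0 < r ->
  measurable (euclidean_ball x r : set (lebesgue_space R N)).
Proof.
by move=> r0; apply: lebesgue_measurable_open; exact: open_euclidean_ball.
Qed.

Lemma sqnormZ (R : realType) (N : nat) (c : R) (v : 'rV[R]_N) :
  sqnorm (c *: v) = c ^+ 2 * sqnorm v.
Proof.
by rewrite /sqnorm big_distrr; apply: eq_bigr => i _; rewrite mxE exprMn.
Qed.

Lemma unit_ball_volumeE (R : realType) (N : nat) :
  lebesgue_outer (euclidean_ball (0 : 'rV[R]_N) 1) =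
  (unit_ball_volume R N)%:E.
Proof.
rewrite /unit_ball_volume fineK// ge0_fin_numE ?outer_measure_ge0//.
(* Any box around the ball shows that [fine] loses nothing. Half-side 2 keeps the strict lower
   inequalities of [box] true after [<] has been weakened to [<=]. *)
apply: (@le_lt_trans _ _
  (lebesgue_outer (box (const_mx (- 2) : 'rV[R]_N) (const_mx 2)))).
  apply: le_outer_measure => z; rewrite euclidean_ballE//= subr0 => /ltW z1 i.
  have := sqnorm_le_coord i ler01 z1; rewrite !mxE ler_norml => /andP[? ?].
  by apply/andP; split; lra.
by rewrite lebesgue_outer_box ?ltry// => i; rewrite !mxE; lra.
Qed.

Lemma euclidean_ball_volume (R : realType) (N : nat) (x : 'rV[R]_N) (r : R) :
  0 < r ->
  lebesgue_outer (euclidean_ball x r) = (unit_ball_volume R N * r ^+ N)%:E.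
Proof.
move=> r0; rewrite (lebesgue_outer_affine x _ r0) mulrC EFinM -unit_ball_volumeE.
congr (_ * lebesgue_outer _)%E; apply/seteqP.
rewrite !euclidean_ballE//; split => z /=;
rewrite subr0 addrC addKr sqnormZ expr1n => h.
  by move: h; rewrite -[ltRHS]mulr1 ltr_pM2l// exprn_gt0.
by rewrite -[ltRHS]mulr1 ltr_pM2l// exprn_gt0.
Qed.

Lemma unit_ball_volume_gt0 (R : realType) (N : nat) :
  0 < unit_ball_volume R N.
Proof.
(* The cube of half-side [e] fits in the ball: since [e <= 1], each squared coordinate is at most
   [e], and they sum to at most [N / (N + 1) < 1]. *)
pose e : R := (N.+1)%:R^-1.
have e0 : 0 < e by rewrite invr_gt0.
rewrite -lte_fin -unit_ball_volumeE.
apply: (@lt_le_trans _ _ (lebesgue_outer (box (const_mx (- e)) (const_mx e : 'rV[R]_N)))).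
  rewrite lebesgue_outer_box => [|i]; last by rewrite !mxE; lra.
  by rewrite lte_fin; apply: prodr_gt0 => i _; rewrite !mxE; lra.
apply: le_outer_measure => z zB; rewrite euclidean_ballE// /= subr0 expr1n.
apply: (@le_lt_trans _ _ (\sum_(i < N) e)).
  apply: ler_sum => i _; have := zB i; rewrite !mxE => /andP[z1 z2].
  have ze : `|z 0 i| <= e by rewrite ler_norml; apply/andP; split; lra.
  have e1 : e <= 1 by rewrite /e invf_le1// ler1n.
  rewrite -real_normK ?num_real// expr2.
  have := normr_ge0 (z 0 i); nra.
rewrite sumr_const card_ord /e -[X in X < _]mulr_natl.
by rewrite ltr_pdivrMr// mul1r ltr_nat ltnSn.
Qed.

Definition cube (R : realType) (N : nat) (k : nat) : set 'rV[R]_N :=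
  box (const_mx (- k%:R)) (const_mx k%:R).

Lemma cube_fin (R : realType) (N k : nat) :
  (lebesgue_outer (@cube R N k) < +oo)%E.
Proof.
rewrite lebesgue_outer_box ?ltry// => i; rewrite !mxE.
have : 0 <= k%:R :> R by []; lra.
Qed.

Lemma bigcup_cube (R : realType) (N : nat) :
  \bigcup_k @cube R N k = setT.
Proof.
apply/seteqP; split=> // x _; pose s := \sum_(i < N) `|x 0 i|.
exists (Num.truncn s).+1 => // i; rewrite !mxE.
have xs : `|x 0 i| < (Num.truncn s).+1%:R.
  apply: le_lt_trans (truncnS_gt s); rewrite /s (bigD1 i)//= lerDl.
  by apply: sumr_ge0.
by move: xs; rewrite ltr_norml => /andP[-> ?]; exact: ltW.
Qed.

Lemma nondecreasing_cube (R : realType) (N : nat) :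
  nondecreasing_seq (@cube R N).
Proof.
move=> j k jk; apply/subsetPset => x xj i; have := xj i.
rewrite !mxE => /andP[? ?]; have : j%:R <= k%:R :> R by rewrite ler_nat.
by move=> ?; apply/andP; split; lra.
Qed.

Lemma lebesgue_sigma_finite (R : realType) (N : nat) :
  sigma_finite (setT : set (lebesgue_space R N)) (lebesgue_measure_rV R N).
Proof.
exists (@cube R N); first by rewrite bigcup_cube.
by move=> k; split; [exact: lebesgue_measurable_box|exact: cube_fin].
Qed.

HB.instance Definition _ (R : realType) (N : nat) :=
  Measure_isSigmaFinite.Build _ (lebesgue_space R N) R
    (lebesgue_measure_rV R N) (lebesgue_sigma_finite R N).

(** * Product structure *)

Definition row_setX (R : realType) (m n : nat) (X : set 'rV[R]_m)
    (Y : set 'rV[R]_n) : set 'rV[R]_(m + n) :=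
  [set z | X (lsubmx z) /\ Y (rsubmx z)].

Lemma row_setX_box (R : realType) (m n : nat) (a b : 'rV[R]_m)
    (c d : 'rV[R]_n) :
  row_setX (box a b) (box c d) = box (row_mx a c) (row_mx b d).
Proof.
apply/seteqP; split=> z /=.
  move=> [zab zcd] i; case: (splitP i) => j ij.
    have -> : i = lshift n j by apply/val_inj.
    by have := zab j; rewrite !row_mxEl !mxE.
  have -> : i = rshift m j by apply/val_inj.
  by have := zcd j; rewrite !row_mxEr !mxE.
move=> zB; split=> i.
  by have := zB (lshift n i); rewrite !row_mxEl !mxE.
by have := zB (rshift m i); rewrite !row_mxEr !mxE.
Qed.

Lemma box_row_mx (R : realType) (m n : nat) (a b : 'rV[R]_(m + n)) :
  box a b = row_setX (box (lsubmx a) (lsubmx b)) (box (rsubmx a) (rsubmx b)).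
Proof. by rewrite row_setX_box !hsubmxK. Qed.

Lemma box_volume_row_mx (R : realType) (m n : nat) (a b : 'rV[R]_m)
    (c d : 'rV[R]_n) :
  box_volume (row_mx a c) (row_mx b d) = box_volume a b * box_volume c d.
Proof.
rewrite /box_volume big_split_ord; congr (_ * _); apply: eq_bigr => i _.
  by rewrite !row_mxEl.
by rewrite !row_mxEr.
Qed.

Lemma lebesgue_outer_setX_box (R : realType) (m n : nat) (a b : 'rV[R]_m)
    (c d : 'rV[R]_n) :
  (forall i, a 0 i <= b 0 i) -> (forall i, c 0 i <= d 0 i) ->
  lebesgue_outer (row_setX (box a b) (box c d)) =
  (lebesgue_outer (box a b) * lebesgue_outer (box c d))%E.
Proof.
move=> ab cd; rewrite row_setX_box !lebesgue_outer_box//.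
  by rewrite box_volume_row_mx EFinM.
move=> i; rewrite !mxE; case: fintype.split => j; [exact: ab|exact: cd].
Qed.

Lemma le_mul_ereal_inf (R : realType) (S : set (\bar R)) (c : R) (y : \bar R) :
  0 <= c -> S !=set0 -> (forall s, S s -> (y <= c%:E * s)%E) ->
  (y <= c%:E * ereal_inf S)%E.
Proof.
rewrite le_eqVlt => /predU1P[<- [s Ss] yS|c0 _ yS].
  by have := yS _ Ss; rewrite !mul0e.
rewrite -lee_pdivrMl//; apply: le_ereal_inf_tmp => s Ss.
by rewrite lee_pdivrMl//; exact: yS.
Qed.

Lemma lebesgue_outer_le_mul (R : realType) (N : nat) (c : R) (y : \bar R)
    (A : set 'rV[R]_N) : 0 <= c ->
  (forall D a b, box_cover A D a b ->
    (y <= \esum_(k in D) (c%:E * lebesgue_outer (box (a k) (b k))))%E) ->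
  (y <= c%:E * lebesgue_outer A)%E.
Proof.
move=> c0 yA; apply: le_mul_ereal_inf => //.
  (* The cubes cover the whole space, so the infimum runs over a nonempty set; when [c = 0] this is
     what gives [y <= 0]. *)
  exists (\esum_(k in setT) (box_volume (const_mx (- k%:R) : 'rV[R]_N) (const_mx k%:R))%:E).
  exists setT, (fun k => const_mx (- k%:R)), (fun k => const_mx k%:R).
  split=> //; split=> [k i|]; last by rewrite -/(@cube R N) bigcup_cube.
  by rewrite !mxE; have : 0 <= k%:R :> R by []; lra.
move=> _ [D [a [b [cov ->]]]].
rewrite -esumZl//; last by move=> k; rewrite lee_fin box_volume_ge0//; exact: cov.1.
apply: le_trans (yA _ _ _ cov) _; apply: le_esum => k _.
by rewrite lebesgue_outer_box//; exact: cov.1.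
Qed.

(** First half of the product inequality for arbitrary sets, in which one factor at a time is
    covered by boxes: here [Y], and [X] in the next lemma. *)
Lemma lebesgue_outer_box_setX_le (R : realType) (m n : nat) (a b : 'rV[R]_m)
    (Y : set 'rV[R]_n) : (forall i, a 0 i <= b 0 i) ->
  (lebesgue_outer (row_setX (box a b) Y) <=
   (box_volume a b)%:E * lebesgue_outer Y)%E.
Proof.
move=> ab; apply: lebesgue_outer_le_mul; first exact: box_volume_ge0.
move=> D c d [cd YD]; rewrite -lebesgue_outer_box//.
apply: (@le_trans _ _ (\esum_(k in D)
    lebesgue_outer (row_setX (box a b) (box (c k) (d k))))%E).
  apply: outer_measure_le_esum => z [zab /YD[k Dk zk]].
  by exists k.
by apply: le_esum => k _; rewrite lebesgue_outer_setX_box.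
Qed.

Lemma lebesgue_outer_setX_le (R : realType) (m n : nat) (X : set 'rV[R]_m)
    (Y : set 'rV[R]_n) : (lebesgue_outer Y < +oo)%E ->
  (lebesgue_outer (row_setX X Y) <= lebesgue_outer X * lebesgue_outer Y)%E.
Proof.
move=> Yoo; have Yfin : lebesgue_outer Y \is a fin_num.
  by rewrite ge0_fin_numE// outer_measure_ge0.
rewrite muleC -(fineK Yfin); apply: lebesgue_outer_le_mul.
  by rewrite fine_ge0// outer_measure_ge0.
move=> D a b [ab XD]; rewrite fineK//.
apply: (@le_trans _ _ (\esum_(k in D)
    lebesgue_outer (row_setX (box (a k) (b k)) Y))%E).
  apply: outer_measure_le_esum => z [/XD[k Dk zk] zY].
  by exists k.
apply: le_esum => k _; rewrite [leRHS]muleC lebesgue_outer_box//.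
exact: lebesgue_outer_box_setX_le.
Qed.

(** The Caratheodory inequality for the cylinder over [A] is checked box by box: a box is [P k]
    times [Q k], and the cylinder cuts only the factor [P k], where [A] is Caratheodory measurable.
    The product inequality bounds the two pieces. *)
Lemma measurable_lsubmx (R : realType) (m n : nat) :
  measurable_fun setT
    ((@lsubmx R 1 m n) : lebesgue_space R (m + n) -> lebesgue_space R m).
Proof.
move=> _ A mA; rewrite setTI; apply: le_caratheodory_measurable => X.
change (lebesgue_outer (X `&` lsubmx @^-1` A) +
  lebesgue_outer (X `&` ~` (lsubmx @^-1` A)) <= lebesgue_outer X)%E.
apply: le_ereal_inf_tmp => _ [D [a [b [[ab XD] ->]]]].
pose P k := box (lsubmx (a k)) (lsubmx (b k)).
pose Q k := box (rsubmx (a k)) (rsubmx (b k)).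
have lab k i : lsubmx (a k) 0 i <= lsubmx (b k) 0 i by rewrite !mxE.
have rab k i : rsubmx (a k) 0 i <= rsubmx (b k) 0 i by rewrite !mxE.
apply: (@le_trans _ _ (\esum_(k in D) lebesgue_outer (row_setX (P k `&` A) (Q k)) +
   \esum_(k in D) lebesgue_outer (row_setX (P k `&` ~` A) (Q k)))%E).
  apply: leeD; apply: outer_measure_le_esum => z [/XD[k Dk zk] zA];
    exists k => //; move: zk; rewrite box_row_mx => -[zl zr];
    by split=> //; split.
rewrite -esumD; try by move=> ? _; exact: outer_measure_ge0.
apply: le_esum => k _.
rewrite -(hsubmxK (a k)) -(hsubmxK (b k)) box_volume_row_mx EFinM.
rewrite -!lebesgue_outer_box// -/(P k) -/(Q k).
have Qoo : (lebesgue_outer (Q k) < +oo)%E by rewrite lebesgue_outer_box// ltry.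
apply: (@le_trans _ _ (lebesgue_outer (P k `&` A) * lebesgue_outer (Q k) +
   lebesgue_outer (P k `&` ~` A) * lebesgue_outer (Q k))%E).
  by apply: leeD; exact: lebesgue_outer_setX_le.
rewrite -ge0_muleDl ?outer_measure_ge0//; apply: lee_wpmul2r.
  exact: outer_measure_ge0.
by rewrite [leRHS](mA (P k)).
Qed.

Lemma measurable_rsubmx (R : realType) (m n : nat) :
  measurable_fun setT
    ((@rsubmx R 1 m n) : lebesgue_space R (m + n) -> lebesgue_space R n).
Proof.
move=> _ A mA; rewrite setTI; apply: le_caratheodory_measurable => X.
change (lebesgue_outer (X `&` rsubmx @^-1` A) +
  lebesgue_outer (X `&` ~` (rsubmx @^-1` A)) <= lebesgue_outer X)%E.
apply: le_ereal_inf_tmp => _ [D [a [b [[ab XD] ->]]]].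
pose P k := box (lsubmx (a k)) (lsubmx (b k)).
pose Q k := box (rsubmx (a k)) (rsubmx (b k)).
have lab k i : lsubmx (a k) 0 i <= lsubmx (b k) 0 i by rewrite !mxE.
have rab k i : rsubmx (a k) 0 i <= rsubmx (b k) 0 i by rewrite !mxE.
apply: (@le_trans _ _ (\esum_(k in D) lebesgue_outer (row_setX (P k) (Q k `&` A)) +
   \esum_(k in D) lebesgue_outer (row_setX (P k) (Q k `&` ~` A)))%E).
  apply: leeD; apply: outer_measure_le_esum => z [/XD[k Dk zk] zA];
    exists k => //; move: zk; rewrite box_row_mx => -[zl zr];
    by split=> //; split.
rewrite -esumD; try by move=> ? _; exact: outer_measure_ge0.
apply: le_esum => k _.
rewrite -(hsubmxK (a k)) -(hsubmxK (b k)) box_volume_row_mx EFinM.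
rewrite -[X in (_ <= _ * X)%E]lebesgue_outer_box// -/(P k) -/(Q k).
apply: (@le_trans _ _ ((box_volume (lsubmx (a k)) (lsubmx (b k)))%:E *
     lebesgue_outer (Q k `&` A) + (box_volume (lsubmx (a k)) (lsubmx (b k)))%:E *
     lebesgue_outer (Q k `&` ~` A))%E).
  by apply: leeD; exact: lebesgue_outer_box_setX_le.
rewrite -ge0_muleDr ?outer_measure_ge0//; apply: lee_wpmul2l.
  by rewrite lee_fin; exact: box_volume_ge0.
by rewrite [leRHS](mA (Q k)).
Qed.

(** This map is measurable, but its inverse is not in general: a Lebesgue null set of the sum
    dimension may have a nonmeasurable slice. Hence the measurability hypotheses of the Tonelli
    lemmas are stated on the product space. *)
Definition row_split (R : realType) (m n : nat) (z : lebesgue_space R (m + n)) :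
  lebesgue_space R m * lebesgue_space R n := (lsubmx z, rsubmx z).

Lemma measurable_row_split (R : realType) (m n : nat) :
  measurable_fun setT (@row_split R m n).
Proof.
by apply: measurable_fun_pair; [exact: measurable_lsubmx|exact: measurable_rsubmx].
Qed.

(* [A `*` B] and two complementary rectangles cover the product of the cubes; the
   inequality [<=] holds for each of the three and their sum is an equality. *)
Lemma lebesgue_outer_setX_cube (R : realType) (m n k : nat)
    (A : set (lebesgue_space R m)) (B : set (lebesgue_space R n)) :
  measurable A -> measurable B -> A `<=` @cube R m k -> B `<=` @cube R n k ->
  lebesgue_outer (row_setX A B) = (lebesgue_outer A * lebesgue_outer B)%E.
Proof.
move=> mA mB Ak Bk.
have cbd N i : (const_mx (- k%:R) : 'rV[R]_N) 0 i <= (const_mx k%:R : 'rV[R]_N) 0 i.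
  by rewrite !mxE; have : 0 <= k%:R :> R by []; lra.
have cfin N (Z : set 'rV[R]_N) : Z `<=` @cube R N k -> lebesgue_outer Z \is a fin_num.
  move=> Zk; rewrite ge0_fin_numE ?outer_measure_ge0//.
  exact: le_lt_trans (le_outer_measure _ _ _ Zk) (cube_fin _ _ _).
set C := @cube R m k; set C' := @cube R n k.
have CA : C `\` A `<=` C by move=> x [].
have CB : C' `\` B `<=` C' by move=> x [].
have compl N (Z : set (lebesgue_space R N)) : measurable Z -> Z `<=` @cube R N k ->
    lebesgue_outer (@cube R N k) =
    (lebesgue_outer Z + lebesgue_outer (@cube R N k `\` Z))%E.
  move=> mZ Zk; rewrite [LHS](mZ (@cube R N k)) setIidr// setDE.
have le1 : (lebesgue_outer C * lebesgue_outer C' <= lebesgue_outer (row_setX A B) +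
    (lebesgue_outer (C `\` A) * lebesgue_outer B +
     lebesgue_outer C * lebesgue_outer (C' `\` B)))%E.
  rewrite -lebesgue_outer_setX_box//.
  apply: (@le_trans _ _ (lebesgue_outer (row_setX A B `|`
      (row_setX (C `\` A) B `|` row_setX C (C' `\` B))))).
    apply: le_outer_measure => z [zC zC'].
    have [zB|zB] := pselect (B (rsubmx z)); last by right; right; split.
    have [zA|zA] := pselect (A (lsubmx z)); first by left.
    by right; left; split.
  apply: le_trans (outer_measureU2 _ _ _) _; apply: leeD => //.
  apply: le_trans (outer_measureU2 _ _ _) _.
  by apply: leeD; apply: lebesgue_outer_setX_le; rewrite -ge0_fin_numE ?outer_measure_ge0//;
    apply: cfin.
apply/eqP; rewrite eq_le lebesgue_outer_setX_le /=; last first.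
  by rewrite -ge0_fin_numE ?outer_measure_ge0//; exact: cfin.
have Coo : (lebesgue_outer (C `\` A) * lebesgue_outer B +
     lebesgue_outer C * lebesgue_outer (C' `\` B))%E \is a fin_num.
  by rewrite fin_numD !fin_numM// cfin.
rewrite -(leeD2rE _ _ Coo); apply: le_trans le1.
rewrite addeA -ge0_muleDl ?outer_measure_ge0// -(compl _ A)//.
by rewrite -ge0_muleDr ?outer_measure_ge0// -(compl _ B).
Qed.


(** Bounded rectangles are treated in the previous lemma; exhausting by cubes and continuity from
    below of both measures give the general case. *)
Lemma pushforward_row_split_setX (R : realType) (m n : nat)
    (A : set (lebesgue_space R m)) (B : set (lebesgue_space R n)) :
  measurable A -> measurable B ->
  pushforward (lam R (m + n)) (@row_split R m n) (A `*` B) =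
  (lam R m A * lam R n B)%E.
Proof.
move=> mA mB.
pose Ak k : set (lebesgue_space R m) := A `&` @cube R m k.
pose Bk k : set (lebesgue_space R n) := B `&` @cube R n k.
have mAk k : measurable (Ak k).
  by apply: measurableI => //; exact: lebesgue_measurable_box.
have mBk k : measurable (Bk k).
  by apply: measurableI => //; exact: lebesgue_measurable_box.
have UAB : \bigcup_k (Ak k `*` Bk k) = A `*` B.
  apply/seteqP; split=> [[x y] [k _] [[/= ? _] [? _]]//|[x y] [/= Ax By]].
  have : (\bigcup_k @cube R m k) x by rewrite bigcup_cube.
  have : (\bigcup_k @cube R n k) y by rewrite bigcup_cube.
  move=> [j _ yj] [i _ xi]; exists (maxn i j) => //=; split; split => //=.
    by have /subsetPset := nondecreasing_cube R m (leq_maxl i j); apply.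
  by have /subsetPset := nondecreasing_cube R n (leq_maxr i j); apply.
have ndAB : nondecreasing_seq (fun k => Ak k `*` Bk k).
  move=> i j ij; apply/subsetPset => -[x y] [[/= Ax xi] [By yi]].
  split; split => //=.
    by have /subsetPset := nondecreasing_cube R m ij; apply.
  by have /subsetPset := nondecreasing_cube R n ij; apply.
have mAB k : measurable (Ak k `*` Bk k) by exact: measurableX.
have mS k : measurable (row_setX (Ak k) (Bk k) : set (lebesgue_space R (m + n))).
  rewrite -[X in measurable X]setTI.
  exact: (@measurable_row_split R m n measurableT _ (mAB k)).
have US : \bigcup_k row_setX (Ak k) (Bk k) = row_setX A B.
  apply/seteqP; split=> [z [k _ /= [[? _] [? _]]]//|z [Az Bz]].
  have : (A `*` B) (lsubmx z, rsubmx z) by [].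
  by rewrite -UAB => -[k _ zk]; exists k.
have ndS : nondecreasing_seq (fun k => row_setX (Ak k) (Bk k)).
  move=> i j ij; apply/subsetPset => z [zA zB].
  have /subsetPset /(_ (lsubmx z, rsubmx z)) := ndAB _ _ ij.
  by case.
have c2 := nondecreasing_cvg_mu (mu := lam R (m + n)) mS
  (bigcup_measurable (fun k _ => mS k)) ndS.
rewrite -product_measure1E// -UAB.
have c1 := nondecreasing_cvg_mu (mu := (lam R m \x lam R n)%E) mAB
  (bigcup_measurable (fun k _ => mAB k)) ndAB.
rewrite -(cvg_lim _ c1)//; apply/esym/cvg_lim => //.
rewrite UAB /pushforward (_ : _ @^-1` _ = row_setX A B)// -US.
rewrite (_ : _ \o _ = lam R (m + n) \o (fun k => row_setX (Ak k) (Bk k)))//.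
apply/funext => k /=; rewrite product_measure1E//.
apply/esym/(@lebesgue_outer_setX_cube R m n k) => //.
  by move=> x [].
by move=> x [].
Qed.

(** The pushforward by [row_split] agrees with the product measure on rectangles, hence everywhere
    by uniqueness of the product measure. Tonelli then follows by a change of variables. *)
Lemma integral_row_mx (R : realType) (m n : nat)
    (f : 'rV[R]_(m + n) -> \bar R) :
  measurable_fun (setT : set (lebesgue_space R m * lebesgue_space R n))
    (fun p => f (row_mx p.1 p.2)) ->
  (forall z, (0 <= f z)%E) ->
  (\int[lam R (m + n)]_z f z =
   \int[lam R m]_x \int[lam R n]_y f (row_mx x y))%E.
Proof.
move=> mf f0.
rewrite (_ : integral _ _ _ = \int[lam R (m + n)]_(z in @row_split R m n @^-1` setT)
   ((fun p => f (row_mx p.1 p.2)) \o @row_split R m n) z)%E; last first.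
  by rewrite preimage_setT; apply: eq_integral => z _ /=; rewrite hsubmxK.
rewrite -ge0_integral_pushforward//; last exact: measurable_row_split.
rewrite -(fubini_tonelli1 (m1 := lam R m) (m2 := lam R n) (fun p => f (row_mx p.1 p.2)) mf)//.
apply: eq_measure_integral; first exact: measurable_row_split.
move=> mrs S mS _; apply/esym; move: S mS.
apply: product_measure_unique => A B mA mB; exact: pushforward_row_split_setX.
Qed.

Lemma integral_row_mx_swap (R : realType) (m n : nat)
    (f : 'rV[R]_(m + n) -> \bar R) :
  measurable_fun (setT : set (lebesgue_space R m * lebesgue_space R n))
    (fun p => f (row_mx p.1 p.2)) ->
  (forall z, (0 <= f z)%E) ->
  (\int[lam R (m + n)]_z f z =
   \int[lam R n]_y \int[lam R m]_x f (row_mx x y))%E.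
Proof.
move=> mf f0; rewrite integral_row_mx//.
exact: (fubini_tonelli (m1 := lam R m) (m2 := lam R n) (fun p => f (row_mx p.1 p.2)) mf).
Qed.

(** * Integration by parts *)

Lemma dominated_convergence_real d (T : measurableType d) (R : realType)
    (mu : {measure set T -> \bar R}) (D : set T) (f_ : nat -> T -> R)
    (f g : T -> R) : measurable D ->
  (forall j, measurable_fun D (f_ j)) ->
  (forall x, D x -> f_ j x @[j --> \oo] --> f x) ->
  mu.-integrable D (EFin \o g) -> (forall j x, D x -> `|f_ j x| <= g x) ->
  mu.-integrable D (EFin \o f) /\
  (\int[mu]_(x in D) (f_ j x)%:E @[j --> \oo] --> \int[mu]_(x in D) (f x)%:E)%E.
Proof.
move=> mD mf fcvg intg fg.
have mE j : measurable_fun D (EFin \o f_ j) by exact/measurable_EFinP.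
have cE x : D x -> (f_ j x)%:E @[j --> \oo] --> (f x)%:E.
  move=> Dx; apply: cvg_EFin; first by near=> j.
  exact: fcvg.
have mfE : measurable_fun D (EFin \o f).
  by apply: emeasurable_fun_cvg mE _ => x Dx; exact: cE.
have [] := dominated_convergence mD mE mfE (aeW _ cE) intg.
  by apply: aeW => x j Dx; rewrite /= lee_fin; exact: fg.
by [].
Unshelve. all: by end_near. Qed.


Lemma cube_measurable (R : realType) (N k : nat) :
  measurable (@cube R N k : set (lebesgue_space R N)).
Proof. exact: lebesgue_measurable_box. Qed.

Lemma bounded_cube_integrable (R : realType) (N k : nat) (M : R)
    (g : 'rV[R]_N -> R) :
  measurable_fun (setT : set (lebesgue_space R N)) (g : lebesgue_space R N -> R) ->
  (forall z, ~ cube k z -> g z = 0) -> (forall z, `|g z| <= M) ->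
  (lam R N).-integrable setT (EFin \o g).
Proof.
move=> mg g0 gM.
have M0 : 0 <= M by exact: le_trans (normr_ge0 (g 0)) (gM 0).
have mg' : measurable_fun setT (EFin \o g : lebesgue_space R N -> \bar R).
  exact/measurable_EFinP.
have m1 : measurable_fun setT
    (fun z : lebesgue_space R N => (\1_(cube k : set (lebesgue_space R N)) z : R)%:E).
  by apply/measurable_EFinP; apply: measurable_indic; exact: cube_measurable.
apply/integrableP; split; first exact: mg'.
apply: (@le_lt_trans _ _ (\int[lam R N]_z
    (M%:E * (\1_(cube k : set (lebesgue_space R N)) z)%:E))%E).
  apply: ge0_le_integral.
  - exact: measurableT.
  - by move=> z _; exact: abse_ge0.
  - exact: measurableT_comp.
  - by apply: emeasurable_funM; [exact: measurable_cst|exact: m1].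
  - move=> z _ /=; rewrite -EFinM lee_fin indicE.
    have [zk|zk] := pselect (cube k z); first by rewrite mem_set// mulr1.
    by rewrite memNset// mulr0 g0// normr0.
rewrite (ge0_integralZl _ measurableT m1).
- rewrite (integral_indic _ measurableT (@cube_measurable R N k)) setIT.
  by rewrite lte_mul_pinfty// cube_fin.
- by move=> z _; rewrite lee_fin.
- by rewrite lee_fin.
Qed.

Lemma integral_translate (R : realType) (N : nat) (v : 'rV[R]_N)
    (f : 'rV[R]_N -> \bar R) :
  (lam R N).-integrable setT f ->
  (lam R N).-integrable setT (fun z => f (v + z)) /\
  (\int[lam R N]_z f (v + z)%R = \int[lam R N]_z f z)%E.
Proof.
move=> intf.
pose phi : lebesgue_space R N -> lebesgue_space R N := fun z => v + z.
have mphi : measurable_fun setT phi by exact: measurable_translation.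
have mf : measurable_fun setT (f : lebesgue_space R N -> \bar R).
  exact: measurable_int intf.
have pE (g : lebesgue_space R N -> \bar R) :
    (\int[pushforward (lam R N) phi]_z g z = \int[lam R N]_z g z)%E.
  apply: eq_measure_integral => A mA _; exact: lebesgue_outer_translate.
have intfv : (lam R N).-integrable setT (f \o phi).
  apply/integrableP; split; first exact: measurableT_comp.
  have /integrableP[_] := intf; rewrite -pE (ge0_integral_pushforward mphi _ measurableT).
  - by [].
  - exact: measurableT_comp.
  - by move=> y _; exact: abse_ge0.
split=> //; rewrite -[RHS]pE integral_pushforward//.
Qed.

Lemma translate_sub_cube (R : realType) (N k : nat) (z : 'rV[R]_N) (s : R)
    (i : 'I_N) : 0 <= s <= 1 -> ~ cube k.+1 z -> ~ cube k (s *: delta_mx 0 i + z).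
Proof.
move=> s01 zk; apply: contra_not zk => zk j; have := zk j.
rewrite !mxE eqxx /= -natr1; case: eqP => _; rewrite ?mulr1 ?mulr0 => /andP[? ?];
by apply/andP; split; lra.
Qed.

(** Mean value theorem on the line through [z] in the direction [e]. The bound does not depend on
    [s], as dominated convergence requires. *)
Lemma diff_quotient_bound (R : realType) (N : nat) (e z : 'rV[R]_N)
    (g g' : 'rV[R]_N -> R) (M s : R) :
  (forall z, is_derive z e g (g' z)) -> (forall z, `|g' z| <= M) -> 0 < s ->
  `|s^-1 * (g (s *: e + z) - g z)| <= M.
Proof.
move=> dg gM s0.
pose f (t : R) := g (t *: e + z).
have df (t : R) : is_derive t 1 f (g' (t *: e + z)).
  have [dgt gt] := dg (t *: e + z).
  have E : (fun h : R => h^-1 *: ((f \o shift t) (h *: 1) - f t)) =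
           (fun h : R => h^-1 *: ((g \o shift (t *: e + z)) (h *: e) - g (t *: e + z))).
    apply/funext => h; rewrite /f /= /shift; congr (_ *: (g _ - _)).
    by rewrite [h *: 1]mulr1 scalerDl addrA.
  by split; [rewrite /derivable E|rewrite /derive E].
have cf : {within `[0, s], continuous f}.
  apply: continuous_subspaceT => t; apply: differentiable_continuous.
  by apply/derivable1_diffP; have [] := df t.
have [c _] := MVT s0 (fun t _ => df t) cf.
rewrite /f scale0r add0r subr0 => ->.
by rewrite mulrCA mulVf ?gt_eqF// mulr1.
Qed.

(* Translation invariance makes the integral of every difference quotient of [g]
   vanish; pass to the limit by dominated convergence. *)
Lemma integral_derivative_eq0 (R : realType) (N k : nat) (i : 'I_N) (M : R)
    (g g' : 'rV[R]_N -> R) :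
  measurable_fun (setT : set (lebesgue_space R N)) (g : lebesgue_space R N -> R) ->
  (forall z, ~ cube k z -> g z = 0) ->
  (forall z, `|g z| <= M) -> (forall z, `|g' z| <= M) ->
  (forall z, is_derive z (delta_mx 0 i) g (g' z)) ->
  (lam R N).-integrable setT (EFin \o g') /\
  (\int[lam R N]_z (g' z)%:E = 0)%E.
Proof.
move=> mg g0 gM g'M dg; set e : 'rV[R]_N := delta_mx 0 i.
have intg := bounded_cube_integrable mg g0 gM.
pose s (j : nat) : R := j.+1%:R^-1.
have s0 j : 0 < s j by rewrite invr_gt0.
have s1 j : s j <= 1 by rewrite invf_le1// ler1n.
pose q (j : nat) (z : 'rV[R]_N) := (s j)^-1 * (g (s j *: e + z) - g z).
have intq j : (lam R N).-integrable setT (EFin \o q j).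
  rewrite (_ : EFin \o _ = (fun z => (s j)^-1%:E * ((g (s j *: e + z))%:E - (g z)%:E))%E)//.
  apply: integrableZl => //; apply: integrableB => //.
  by have [] := integral_translate (s j *: e) intg.
have intq0 j : (\int[lam R N]_z (q j z)%:E = 0)%E.
  rewrite (_ : (fun z => _) = (fun z => (s j)^-1%:E * ((g (s j *: e + z))%:E - (g z)%:E))%E)//.
  have [it itE] := integral_translate (s j *: e) intg.
  rewrite integralZl//; last exact: integrableB.
  rewrite integralB// itE subee ?mule0//.
  exact: integrable_fin_num.
have qcvg z : q j z @[j --> \oo] --> g' z.
  have [dgz gz] := dg z; rewrite -gz.
  have s_cvg : s j @[j --> \oo] --> (0 : R)^'.
    move=> A hA.
    have hA' : nbhs (0 : R) (fun y : R => y != 0 -> A y) by exact: hA.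
    have := cvg_harmonic hA'; apply: (@filterS _ \oo) => j /=; apply.
    by rewrite gt_eqF// s0.
  rewrite (_ : (fun j => _) =
    (fun h : R => h^-1 *: ((g \o shift z) (h *: e) - g z)) \o s)//.
  exact: cvg_comp s_cvg dgz.
(* All steps [s j] are at most 1, so the quotients of a function vanishing off [cube k] vanish off
   [cube k.+1]: a single dominating function serves every [j]. *)
have bq j z : `|q j z| <= M * \1_(cube k.+1) z.
  rewrite indicE; have [zk|zk] := pselect (cube k.+1 z).
    by rewrite mem_set// mulr1; apply: (@diff_quotient_bound _ _ _ _ g g') => //.
  rewrite memNset// mulr0 /q !g0 ?subrr ?mulr0 ?normr0//.
    apply: contra_not zk; have /subsetPset := nondecreasing_cube R N (leqnSn k).
    exact.
  by apply: translate_sub_cube => //; rewrite s1 andbT ltW.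
have intM : (lam R N).-integrable setT
    (EFin \o (fun z => M * \1_(cube k.+1 : set (lebesgue_space R N)) z)).
  apply: (@bounded_cube_integrable _ _ k.+1 `|M|) => [|z zk|z].
  - apply: measurable_funM; first exact: measurable_cst.
    by apply: measurable_indic; exact: cube_measurable.
  - by rewrite indicE memNset// mulr0.
  - by rewrite normrM indicE; case: (_ \in _); rewrite ?normr1 ?normr0 ?mulr1 ?mulr0.
have mq j : measurable_fun setT (q j : lebesgue_space R N -> R).
  apply/measurable_EFinP; exact: measurable_int (intq j).
have [ig' lim0] := dominated_convergence_real measurableT mq
  (fun z _ => qcvg z) intM (fun j z _ => bq j z).
split=> //; rewrite -(cvg_lim _ lim0)//.
rewrite (_ : (fun j => _) = cst 0%E); last by apply/funext => j; exact: intq0.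
exact: lim_cst.
Qed.

Lemma continuous_measurable_on_open (R : realType) (N : nat)
    (U : set 'rV[R]_N) (f : 'rV[R]_N -> R) :
  open U -> (forall x, U x -> {for x, continuous f}) ->
  measurable_fun (U : set (lebesgue_space R N)) (f : lebesgue_space R N -> R).
Proof.
move=> oU cf; apply: (measurability _ (RGenOpens.measurableE R)) => _ [_ [a [b ->]] <-].
apply: lebesgue_measurable_open; rewrite openE => x [Ux fx].
apply: filterI; first by apply: open_nbhs_nbhs.
apply: cf => //; apply: open_nbhs_nbhs; split => //; exact: interval_open.
Qed.

Lemma continuous_compact_bounded (R : realType) (N : nat) (C : set 'rV[R]_N)
    (f : 'rV[R]_N -> R) : compact C ->
  (forall x, C x -> {for x, continuous f}) ->
  exists2 M, 0 <= M & forall x, C x -> `|f x| <= M.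
Proof.
move=> cC cf.
have /compact_bounded [M [Mr fM]] : compact (f @` C).
  apply: continuous_compact => //; apply: continuous_in_subspaceT => x.
  by rewrite inE => /cf.
exists (`|M| + 1) => [|x Cx]; first by rewrite addr_ge0.
apply: (fM (`|M| + 1)); last by exists x.
by apply: le_lt_trans (ler_norm M) _; rewrite ltrDl.
Qed.

Lemma is_derive_coordB (R : realType) (N : nat) (x0 z : 'rV[R]_N)
    (i j : 'I_N) :
  is_derive z (delta_mx 0 i) (fun z : 'rV[R]_N => (z - x0) 0 j) (i == j)%:R.
Proof.
have E : (fun h : R => h^-1 *: (((fun z : 'rV[R]_N => (z - x0) 0 j) \o shift z)
    (h *: delta_mx 0 i) - (z - x0) 0 j)) h @[h --> 0^'] --> ((i == j)%:R : R).
  apply: cvg_near_cst; near=> h.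
  have h0 : h != 0 by near: h; exact: nbhs_dnbhs_neq.
  rewrite /= !mxE eqxx /= (eq_sym j) /GRing.scale /=.
  by field.
by split; [apply/cvg_ex; eexists; exact: E|exact: cvg_lim E].
Unshelve. all: by end_near. Qed.

Lemma is_derive_sqnormB (R : realType) (N : nat) (x0 z : 'rV[R]_N)
    (i : 'I_N) :
  is_derive z (delta_mx 0 i) (fun z : 'rV[R]_N => sqnorm (z - x0))
    (2 * (z - x0) 0 i).
Proof.
pose c j (z : 'rV[R]_N) := (z - x0) 0 j.
rewrite (_ : (fun z => _) = \sum_(j < N) (c j ^+ 2)); last first.
  by apply/funext => y; rewrite fct_sumE.
have dc j := is_deriveX 2 (is_derive_coordB x0 z i j).
apply: is_derive_eq (is_derive_sum dc) _.
rewrite (bigD1 i)//= eqxx expr1 big1 => [|j /negbTE ji].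
  by rewrite addr0 [LHS]mulr1.
by rewrite eq_sym ji [LHS]mulr0.
Qed.

(** Each difference quotient of the extension by 0 is either that of [f], which tends to 0, or 0. It
    is meant for points of the sphere bounding a ball. *)
Lemma is_derive_restrict (R : realType) (N : nat) (z v : 'rV[R]_N)
    (S : set 'rV[R]_N) (f g : 'rV[R]_N -> R) :
  is_derive z v f 0 -> f z = 0 -> (forall y, S y -> g y = f y) ->
  (forall y, ~ S y -> g y = 0) -> is_derive z v g 0.
Proof.
move=> [df fz0] fz gS gN.
have gz : g z = 0 by have [/gS ->|/gN ->] := pselect (S z).
have fcvg : (fun h : R => h^-1 *: ((f \o shift z) (h *: v) - f z)) h @[h --> 0^'] --> 'D_v f z.
  exact: df.
rewrite fz0 in fcvg.
have gcvg : (fun h : R => h^-1 *: ((g \o shift z) (h *: v) - g z)) h @[h --> 0^'] --> (0 : R).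
  apply/cvgrPdist_lt => e e0; move/cvgrPdist_lt : fcvg => /(_ e e0).
  apply: filterS => h; rewrite !sub0r !normrN gz fz !subr0 /=.
  have [/gS ->//|/gN -> _] := pselect (S (h *: v + z)).
  by rewrite scaler0 normr0.
by split; [apply/cvg_ex; eexists; exact: gcvg|exact: cvg_lim gcvg].
Qed.

Lemma measurable_fun_extend0 d (T : measurableType d) (R : realType)
    (B : set T) (f g : T -> R) : measurable B -> measurable_fun B f ->
  (forall x, B x -> g x = f x) -> (forall x, ~ B x -> g x = 0) ->
  measurable_fun setT g.
Proof.
move=> mB mf gB gN; rewrite -(setUv B); apply/measurable_funU => //.
  exact: measurableC.
have m0 : measurable_fun (~` B) (cst 0 : T -> R) by exact: measurable_cst.
split; first by apply: eq_measurable_fun mf => x; rewrite inE => /gB ->.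
by apply: eq_measurable_fun m0 => x; rewrite inE => /gN ->.
Qed.

Lemma sqnorm_le_sub_cube (R : realType) (N : nat) (x0 : 'rV[R]_N) (t : R) :
  0 <= t -> exists k, [set z | sqnorm (z - x0) <= t] `<=` @cube R N k.
Proof.
move=> t0; pose s := Num.sqrt t + \sum_(i < N) `|x0 0 i|.
exists (Num.truncn s).+1 => z /= zt i; rewrite !mxE.
have x0s : `|x0 0 i| <= \sum_(i < N) `|x0 0 i|.
  by rewrite (bigD1 i)//= lerDl sumr_ge0.
have zx : `|(z - x0) 0 i| <= Num.sqrt t.
  by apply: sqnorm_le_coord; rewrite ?sqrtr_ge0// sqr_sqrtr.
have sk := truncnS_gt s.
move: x0s zx sk; rewrite /s !mxE !ler_norml => ? /andP[? ?] ?.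
have := ler_norm (x0 0 i); have := ler_norm (- x0 0 i); rewrite normrN.
by move=> ? ?; apply/andP; split; lra.
Qed.

Lemma compact_sqnorm_le (R : realType) (N : nat) (x0 : 'rV[R]_N) (t : R) :
  0 < t -> compact [set z | sqnorm (z - x0) <= t].
Proof.
move=> t0; have st0 : 0 < Num.sqrt t by rewrite sqrtr_gt0.
have := compact_closed_euclidean_ball (x := x0) st0.
by rewrite closed_euclidean_ballE// sqr_sqrtr// ltW.
Qed.

(* With [w = (t - |z - x0|^2)^3] on the ball and 0 outside, the fields
   [g_i = w d_i h - h d_i w] are differentiable on the whole space, and
   [sum_i d_i g_i = w (laplacian h) - h (laplacian w)] where [laplacian h = 0]. *)
Lemma weighted_harmonic_identity (R : realType) (N : nat)
    (D : set 'rV[R]_N) (h : 'rV[R]_N -> R) (x0 : 'rV[R]_N) (t : R) :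
  0 < t -> harmonic_on D h -> [set z | sqnorm (z - x0) <= t] `<=` D -> open D ->
  (\int[lam R N]_(z in [set z | (sqnorm (z - x0) < t)%R])
     (h z * (4 * t * (t - sqnorm (z - x0)) -
             (N%:R + 4) * (t - sqnorm (z - x0)) ^+ 2))%:E = 0)%E.
Proof.
move=> t0 [C2h lap0] CD oD.
set B := [set z | _ < _]; set C := [set z | _ <= _] in CD.
have BC : B `<=` C by move=> z /ltW.
have cC : compact C by exact: compact_sqnorm_le.
have mB : measurable (B : set (lebesgue_space R N)).
  by apply: lebesgue_measurable_open; exact: open_sqnorm_lt.
pose w (z : 'rV[R]_N) : R := t - sqnorm (z - x0).
pose c i (z : 'rV[R]_N) : R := (z - x0) 0 i.
(* Here [w] is [t - |z - x0|^2] and the weight is [w^3]; as [d_i w = - 2 c_i], this is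
   [w^3 d_i h - h d_i (w^3)]. The exponent 3 is the least integer for which [d_i (w^3)] vanishes to
   second order on the sphere, so that the extension by 0 stays differentiable. *)
pose F i (z : 'rV[R]_N) : R := w z ^+ 3 * partial i h z + 6 * c i z * w z ^+ 2 * h z.
(* The two terms [6 c_i w^2 d_i h], one from each summand of [F i], have opposite signs and
   cancel. *)
pose F' i (z : 'rV[R]_N) : R := w z ^+ 3 * partial i (partial i h) z +
  h z * (6 * w z ^+ 2 - 24 * c i z ^+ 2 * w z).
have dF i z : D z -> is_derive z (delta_mx 0 i) (F i) (F' i z).
  move=> /C2h [_ dh _ ddh _].
  have dw : is_derive z (delta_mx 0 i) w (- (2 * c i z)).
    have := is_deriveB (is_derive_cst t z (delta_mx 0 i)) (is_derive_sqnormB x0 z i).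
    by rewrite sub0r.
  have dc : is_derive z (delta_mx 0 i) (c i) 1.
    by have := is_derive_coordB x0 z i i; rewrite eqxx.
  have d1 := is_deriveM (is_deriveX 3 dw) (derivableP (ddh i i)).
  have d2 := is_deriveM (is_deriveM (is_deriveM (is_derive_cst (6 : R) z (delta_mx 0 i)) dc)
    (is_deriveX 2 dw)) (derivableP (dh i)).
  have := is_deriveD d1 d2.
  rewrite (_ : _ + _ = F i); last by apply/funext => y; rewrite /F /=.
  move/is_derive_eq; apply.
  rewrite /F' /GRing.scale /= -/(partial i h z) -/(partial i (partial i h) z).
  rewrite !fctE /cst /=; ring.
have cw z : {for z, continuous w}.
  by apply: continuousB; [exact: cst_continuous|exact: continuous_sqnormB].
have cc i z : {for z, continuous (c i)} by exact: continuous_coordB.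
have c1 (a : R) (z : 'rV[R]_N) : {for z, continuous (fun _ : 'rV[R]_N => a)}.
  exact: cst_continuous.
have cF i z : D z -> {for z, continuous (F i)}.
  move=> /C2h [ch _ dh _ _]; apply: continuousD; apply: continuousM.
  - exact: continuous_exp_at.
  - exact: dh.
  - apply: continuousM; last exact: continuous_exp_at.
    by apply: continuousM; [exact: c1|exact: cc].
  - exact: ch.
have cF' i z : D z -> {for z, continuous (F' i)}.
  move=> /C2h [ch _ _ _ ddh]; apply: continuousD; apply: continuousM.
  - exact: continuous_exp_at.
  - exact: ddh.
  - exact: ch.
  - apply: continuousB; apply: continuousM => //; first exact: continuous_exp_at.
    by apply: continuousM => //; exact: continuous_exp_at.
pose g i (z : 'rV[R]_N) := if z \in B then F i z else 0.
pose g' i (z : 'rV[R]_N) := if z \in B then F' i z else 0.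
have gB i z : B z -> g i z = F i z by move=> zB; rewrite /g mem_set.
have gNB i z : ~ B z -> g i z = 0 by move=> zB; rewrite /g memNset.
have g'B i z : B z -> g' i z = F' i z by move=> zB; rewrite /g' mem_set.
have g'NB i z : ~ B z -> g' i z = 0 by move=> zB; rewrite /g' memNset.
have dg i z : is_derive z (delta_mx 0 i) (g i) (g' i z).
  have [zt|zt|zt] := ltgtP (sqnorm (z - x0)) t.
  - rewrite g'B//; apply: near_eq_is_derive (dF i z (CD _ (ltW zt))).
    have : nbhs z B by apply: open_nbhs_nbhs; split => //; exact: open_sqnorm_lt.
    by apply: filterS => y /gB ->.
  - rewrite g'NB; last by rewrite /B /=; apply/negP; rewrite -leNgt ltW.
    apply: near_eq_is_derive (is_derive_cst 0 _ _).
    have : nbhs z (~` C).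
      apply: open_nbhs_nbhs; split; last by apply/negP; rewrite -ltNge.
      by apply: closed_openC; exact: closed_sqnorm_le.
    by apply: filterS => y yC; rewrite gNB// => /BC.
  (* On the sphere [w = 0], hence [F i] and [F' i] both vanish there. *)
  - have nBz : ~ B z by rewrite /B /= zt ltxx.
    have wz : w z = 0 by rewrite /w zt subrr.
    rewrite g'NB//; apply: (@is_derive_restrict _ _ _ _ B (F i)).
    + apply: is_derive_eq (dF i z (CD _ _)) _; first by rewrite /C /= zt.
      by rewrite /F' wz; ring.
    + by rewrite /F wz; ring.
    + exact: gB.
    + exact: gNB.
have /choice[M1 M1P] : forall i, exists M, 0 <= M /\ forall z, C z -> `|F i z| <= M.
  move=> i; have [M M0 MF] := continuous_compact_bounded cC (fun z Cz => cF i z (CD _ Cz)).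
  by exists M.
have /choice[M2 M2P] : forall i, exists M, 0 <= M /\ forall z, C z -> `|F' i z| <= M.
  move=> i; have [M M0 MF] := continuous_compact_bounded cC (fun z Cz => cF' i z (CD _ Cz)).
  by exists M.
have [k Ck] := sqnorm_le_sub_cube x0 (ltW t0).
have Bk : B `<=` @cube R N k by apply: subset_trans Ck.
have key i : (lam R N).-integrable setT (EFin \o g' i) /\
    (\int[lam R N]_z (g' i z)%:E = 0)%E.
  apply: (@integral_derivative_eq0 _ _ k i (M1 i + M2 i) (g i)).
  - apply: (measurable_fun_extend0 mB _ (gB i) (gNB i)).
    apply: continuous_measurable_on_open; first exact: open_sqnorm_lt.
    by move=> z /BC /CD; exact: cF.
  - by move=> z zk; apply: gNB => /Bk.
  - move=> z; have [M10 M1F] := M1P i; have [M20 _] := M2P i.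
    have [zB|zB] := pselect (B z); last by rewrite gNB// normr0 addr_ge0.
    by rewrite gB//; apply: le_trans (M1F _ (BC _ zB)) _; rewrite lerDl.
  - move=> z; have [M10 M1F] := M2P i; have [M20 _] := M1P i.
    have [zB|zB] := pselect (B z); last by rewrite g'NB// normr0 addr_ge0.
    by rewrite g'B//; apply: le_trans (M1F _ (BC _ zB)) _; rewrite lerDr.
have sum0 : (\int[lam R N]_z (\sum_(i < N) (g' i z)%:E) = 0)%E.
  rewrite (integral_sum measurableT (fun i => (key i).1)).
  by apply: big1 => i _; exact: (key i).2.
have isum := @integrable_sum _ _ _ (lam R N) _ measurableT _ (index_enum 'I_N)
  xpredT _ (fun i _ => (key i).1).
rewrite integral_mkcond.
(* Since [|z - x0|^2 = t - w], the sum of the [F' i] is [h (6 N w^2 - 24 (t - w) w) = - 6 h (4 t w -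
   (N + 4) w^2)]: this is the origin of [N + 4] and of the factor [- 6^-1]. *)
rewrite (_ : _ \_ B = (fun z => (- 6^-1)%:E * (\sum_(i < N) (g' i z)%:E))%E).
  by rewrite (integralZl measurableT isum) sum0 mule0.
apply/funext => z; rewrite patchE sumEFin -EFinM.
have [zB|zB] := pselect (B z); last first.
  by rewrite memNset// big1 ?mulr0// => i _; exact: g'NB.
rewrite mem_set//; congr (_%:E).
under eq_bigr => i _ do rewrite g'B// /F'.
rewrite big_split /= -mulr_sumr -/(laplacian h z) lap0; last exact: CD (BC _ zB).
rewrite mulr0 add0r -mulr_sumr sumrB sumr_const card_ord -mulr_suml -mulr_sumr.
rewrite -/(sqnorm (z - x0)) /w -mulr_natl; by field.
Qed.

(** * The mean value property of harmonic functions *)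

Lemma integrable_scale d (T : measurableType d) (R : realType)
    (mu : {measure set T -> \bar R}) (D : set T) (c : R) (f : T -> R) :
  measurable D -> mu.-integrable D (EFin \o f) ->
  mu.-integrable D (EFin \o (fun x => c * f x)).
Proof.
move=> mD intf; rewrite (_ : _ \o _ = (fun x => c%:E * (EFin \o f) x)%E)//.
exact: integrableZl.
Qed.

Lemma integrable_sub d (T : measurableType d) (R : realType)
    (mu : {measure set T -> \bar R}) (D : set T) (f g : T -> R) :
  measurable D -> mu.-integrable D (EFin \o f) ->
  mu.-integrable D (EFin \o g) ->
  mu.-integrable D (EFin \o (fun x => f x - g x)).
Proof.
move=> mD intf intg.
rewrite (_ : _ \o _ = ((EFin \o f) \- (EFin \o g))%E)//.
exact: integrableB.
Qed.

(** A quadratic remainder bound survives integration in a parameter, so an integral can be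
    differentiated in this form without a separate limit theorem. *)
Lemma is_derive_quadratic_error (R : realType) (f : R -> R) (x l K : R) :
  (forall d, `|f (x + d) - f x - l * d| <= K * d ^+ 2) -> is_derive x 1 f l.
Proof.
move=> fK.
have K0 : 0 <= K by have := le_trans (normr_ge0 _) (fK 1); rewrite expr1n mulr1.
have fcvg : (fun h : R => h^-1 *: ((f \o shift x) (h *: 1) - f x)) h @[h --> 0^'] --> l.
  apply/cvgrPdist_le => e e0; near=> h.
  have h0 : h != 0 by near: h; exact: nbhs_dnbhs_neq.
  rewrite distrC /= [h *: 1]mulr1 (addrC h x) /GRing.scale /=.
  have -> : h^-1 * (f (x + h) - f x) - l = h^-1 * (f (x + h) - f x - l * h).
    by field.
  rewrite normrM normfV ler_pdivrMl ?normr_gt0//; apply: le_trans (fK h) _.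
  rewrite -real_normK ?num_real// expr2 mulrA mulrC ler_pM2l ?normr_gt0//.
  have he : `|h| <= e / (K + 1).
    near: h; apply: dnbhs0_le; rewrite divr_gt0// ltr_wpDl//.
  rewrite ler_pdivlMr ?ltr_wpDl// in he.
  apply: le_trans he; rewrite mulrC ler_wpM2l// lerDl//.
by split; [apply/cvg_ex; eexists; exact: fcvg|exact: cvg_lim fcvg].
Unshelve. all: by end_near. Qed.

(** The squared positive part has a Lipschitz derivative, whereas the positive part itself has a
    kink. This is why the differential equation is written for [P 2] and not for [P 1]. *)
Lemma pos_part_sqr_error (R : realFieldType) (a d : R) :
  `|Num.max (a + d) 0 ^+ 2 - Num.max a 0 ^+ 2 - 2 * Num.max a 0 * d| <= d ^+ 2.
Proof.
by rewrite ler_norml; case: (leP a 0) => ?; case: (leP (a + d) 0) => ?;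
  apply/andP; split; nra.
Qed.

(* [P k s] is the integral over the ball [rho < s] of [(s - rho)^k h]; the
   weighted identity reads [4 s P_1 = (N + 4) P_2], while [P_2' = 2 P_1]. Hence
   [P_2^2 / s^(N+4)] is constant, and it tends to 0 with [s] because [h x0 = 0].
   So [P_1 = 0], and the integral of [h] is the left derivative of [P_1]. *)
Section harmonic_mean_value.
Variables (R : realType) (N : nat) (D : set 'rV[R]_N) (h : 'rV[R]_N -> R).
Variables (x0 : 'rV[R]_N) (T : R).
Hypotheses (oD : open D) (hD : harmonic_on D h) (T0 : 0 < T) (hx0 : h x0 = 0).
Let rho (z : 'rV[R]_N) : R := sqnorm (z - x0).
Let C : set 'rV[R]_N := [set z | rho z <= T].
Let B (t : R) : set 'rV[R]_N := [set z | rho z < t].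
Hypothesis CD : C `<=` D.
(** Taking the positive part makes every [P k s] an integral over the fixed set [C]; for [0 < k] and
    [s <= T] the integrand vanishes off [B s]. *)
Let pp (s : R) (z : 'rV[R]_N) : R := Num.max (s - rho z) 0.
Let P (k : nat) (s : R) : R :=
  Rintegral (lam R N) (C : set (lebesgue_space R N)) (fun z => pp s z ^+ k * h z).

Let mC : measurable (C : set (lebesgue_space R N)).
Proof. by apply: lebesgue_measurable_closed; exact: closed_sqnorm_le. Qed.

Let mB t : measurable (B t : set (lebesgue_space R N)).
Proof. by apply: lebesgue_measurable_open; exact: open_sqnorm_lt. Qed.

Let mh : measurable_fun (C : set (lebesgue_space R N)) (h : lebesgue_space R N -> R).
Proof.
apply: (@measurable_funS _ _ _ _ (D : set (lebesgue_space R N))) => //.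
  exact: lebesgue_measurable_open.
by apply: continuous_measurable_on_open => // x /hD.1 [].
Qed.

Let Coo : (lam R N C < +oo)%E.
Proof.
have [k Ck] := sqnorm_le_sub_cube x0 (ltW T0).
exact: le_lt_trans (le_outer_measure _ _ _ Ck) (cube_fin _ _ _).
Qed.

Let bounded_integrable (f : 'rV[R]_N -> R) (M : R) :
  measurable_fun (C : set (lebesgue_space R N)) (f : lebesgue_space R N -> R) ->
  (forall z, C z -> `|f z| <= M) -> (lam R N).-integrable C (EFin \o f).
Proof.
move=> mf fM; apply: measurable_bounded_integrable mC Coo mf _.
by exists M; split => [|x xM z Cz]; [exact: num_real|exact: le_trans (fM z Cz) (ltW xM)].
Qed.

Let hbound : exists2 M : R, 0 <= M & forall z, C z -> `|h z| <= M.
Proof.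
apply: continuous_compact_bounded; first exact: compact_sqnorm_le.
by move=> z /CD /hD.1 [].
Qed.

Let mpp s : measurable_fun setT (pp s : lebesgue_space R N -> R).
Proof.
have mrho : measurable_fun setT (rho : lebesgue_space R N -> R).
  apply: continuous_measurable_on_open; first exact: openT.
  by move=> x _; exact: continuous_sqnormB.
apply: measurable_maxr; last exact: measurable_cst.
by apply: measurable_funB; [exact: measurable_cst|exact: mrho].
Qed.

Let pp_ge0 s z : 0 <= pp s z. Proof. by rewrite /pp le_max lexx orbT. Qed.

Let pp_le s z : pp s z <= `|s|.
Proof.
rewrite /pp ge_max normr_ge0 andbT; apply: le_trans (ler_norm s).
by rewrite gerBl; exact: sqnorm_ge0.
Qed.

Let mpph k s : measurable_fun (C : set (lebesgue_space R N))
  ((fun z => pp s z ^+ k * h z) : lebesgue_space R N -> R).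
Proof.
apply: measurable_funM; last exact: mh.
apply: measurable_funX; by apply: measurable_funTS; exact: mpp.
Qed.

Let intP k s : (lam R N).-integrable C (EFin \o (fun z => pp s z ^+ k * h z)).
Proof.
have [M M0 hM] := hbound.
apply: (@bounded_integrable _ (`|s| ^+ k * M)) => [|z Cz]; first exact: mpph.
rewrite normrM normrX (ger0_norm (pp_ge0 s z)).
by apply: ler_pM => //; [exact: exprn_ge0|by apply: lerXn2r; rewrite ?nnegrE|exact: hM].
Qed.

Let P12 (s : R) : 0 < s -> s <= T -> 4 * s * P 1 s = (N%:R + 4) * P 2 s.
Proof.
move=> s0 sT.
have := @weighted_harmonic_identity R N D h x0 s s0 hD _ oD.
have CsD : [set z | sqnorm (z - x0) <= s] `<=` D.
  by move=> z zs; apply: CD; exact: le_trans sT.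
move=> /(_ CsD); rewrite integral_mkcond.
rewrite (_ : _ \_ _ = (fun z : lebesgue_space R N =>
   (4 * s * (pp s z ^+ 1 * h z) - (N%:R + 4) * (pp s z ^+ 2 * h z))%:E) \_ C).
  rewrite -integral_mkcond => int0; apply/eqP; rewrite -subr_eq0; apply/eqP.
  rewrite /P -!RintegralZl// -RintegralB//.
  - by rewrite /Rintegral int0.
  - exact: integrable_scale.
  - exact: integrable_scale.
apply/funext => z; rewrite !patchE.
have [zs|zs] := ltP (sqnorm (z - x0)) s.
  rewrite mem_set// mem_set; last by rewrite /C /=; exact: ltW (lt_le_trans zs sT).
  rewrite /pp max_l ?subr_ge0 ?ltW//; congr (_%:E); rewrite /rho; ring.
rewrite memNset; last by apply/negP; rewrite -leNgt.
case: ifP => // _; rewrite /pp max_r ?subr_le0//; congr (_%:E); ring.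
Qed.

Let dP2 (s : R) : is_derive s 1 (P 2) (2 * P 1 s).
Proof.
have [M M0 hM] := hbound.
have inth : (lam R N).-integrable C (EFin \o h) by exact: (bounded_integrable mh hM).
have intnh : (lam R N).-integrable C (EFin \o (fun z => `|h z|)).
  by have := integrable_abse inth.
apply: (@is_derive_quadratic_error _ _ _ _
  (Rintegral (lam R N) C (fun z => `|h z|))) => d.
have i1 : (lam R N).-integrable C
    (EFin \o (fun z => pp (s + d) z ^+ 2 * h z - pp s z ^+ 2 * h z)).
  exact: integrable_sub.
have i2 : (lam R N).-integrable C (EFin \o (fun z => (2 * d) * (pp s z ^+ 1 * h z))).
  exact: integrable_scale.
have i3 : (lam R N).-integrable C (EFin \o (fun z =>
    pp (s + d) z ^+ 2 * h z - pp s z ^+ 2 * h z - (2 * d) * (pp s z ^+ 1 * h z))).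
  exact: integrable_sub.
have -> : 2 * P 1 s * d = (2 * d) * P 1 s by ring.
rewrite /P -RintegralB// -RintegralZl// -RintegralB//.
apply: le_trans (le_normr_Rintegral mC i3) _.
rewrite [leRHS]mulrC -RintegralZl//; apply: le_Rintegral => //.
- by have := integrable_abse i3.
- exact: integrable_scale.
move=> z _.
have -> : pp (s + d) z ^+ 2 * h z - pp s z ^+ 2 * h z - 2 * d * (pp s z ^+ 1 * h z) =
  (pp (s + d) z ^+ 2 - pp s z ^+ 2 - 2 * pp s z * d) * h z by ring.
rewrite normrM ler_wpM2r// /pp (addrAC s d (- rho z)); exact: pos_part_sqr_error.
Qed.

(** The two relations give [s P_2' = (N + 4) / 2 P_2], so [P_2] is proportional to the power
    [(N + 4) / 2] of [s]. Squaring avoids a half-integer exponent. *)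
Let G (s : R) : R := P 2 s ^+ 2 * (s ^+ (N + 4))^-1.

Let dG (s : R) : 0 < s -> s <= T -> is_derive s 1 G 0.
Proof.
move=> s0 sT.
have sN0 : s ^+ (N + 4) != 0 by rewrite gt_eqF// exprn_gt0.
have d1 := is_deriveX 2 (dP2 s).
have d0 : is_derive s 1 (fun s : R => s ^+ (N + 4)) ((N + 4)%:R * s ^+ (N + 3)).
  have := is_deriveX (N + 4) (is_derive_id s (1 : R)).
  rewrite exprfctE => /is_derive_eq; apply.
  by rewrite [LHS]mulr1 addnS.
have d2 := @is_deriveV R (fun s => s ^+ (N + 4)) s _ 1 sN0 d0.
have := is_deriveM d1 d2.
rewrite (_ : _ * _ = G); last by apply/funext.
move/is_derive_eq; apply; rewrite /GRing.scale /=.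
have e := P12 s0 sT.
have -> : P 1 s = (N%:R + 4) / (4 * s) * P 2 s.
  by apply: (mulfI (x := 4 * s)); [rewrite mulf_neq0 ?gt_eqF|rewrite e; field; rewrite gt_eqF].
rewrite !fctE /= natrD !exprD.
have : s ^+ N != 0 by rewrite gt_eqF// exprn_gt0.
move: (s ^+ N) (P 2 s) => a p a0; field.
by rewrite a0 gt_eqF.
Qed.

Let G_cst (s : R) : 0 < s -> s <= T -> G s = G T.
Proof.
move=> s0; rewrite le_eqVlt => /predU1P[->//|sT].
have dGs x : x \in `]s, T[ -> is_derive x 1 G 0.
  by rewrite in_itv /= => /andP[sx xT]; apply: dG; [exact: lt_trans sx|exact: ltW].
have cG : {within `[s, T], continuous G}.
  apply: continuous_in_subspaceT => x; rewrite inE /= in_itv /= => /andP[sx xT].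
  apply: differentiable_continuous; apply/derivable1_diffP.
  by have [] := dG (lt_le_trans s0 sx) xT.
have [c _ /eqP] := MVT sT dGs cG.
by rewrite mul0r subr_eq0 => /eqP.
Qed.

(** The weight is at most [s^2], and [B s] is a ball of radius [sqrt s], whose volume is of order
    [s^(N/2)]. The square of the bound carries exactly [s^(N + 4)], the denominator of [G], so only
    [e] is left to tend to 0. *)
Let P2_le (e s : R) : 0 < e -> 0 < s -> s <= T ->
  (forall z, B s z -> `|h z| <= e) ->
  `|P 2 s| <= s ^+ 2 * e * (unit_ball_volume R N * Num.sqrt s ^+ N).
Proof.
move=> e0 s0 sT he.
have BsC : B s `<=` C by move=> z; rewrite /B /C /=; lra.
have m1 : measurable_fun (C : set (lebesgue_space R N))
    (\1_(B s : set (lebesgue_space R N)) : lebesgue_space R N -> R).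
  exact: measurable_indic.
have i1 : (lam R N).-integrable C
    (EFin \o (\1_(B s : set (lebesgue_space R N)) : lebesgue_space R N -> R)).
  apply: (@bounded_integrable _ 1) => // z _.
  by rewrite indicE; case: (_ \in _); rewrite ?normr1 ?normr0.
have -> : unit_ball_volume R N * Num.sqrt s ^+ N =
    Rintegral (lam R N) C (\1_(B s : set (lebesgue_space R N))).
  rewrite /Rintegral (integral_indic _ mC (mB s)) setIidl//.
  have := euclidean_ball_volume x0 (r := Num.sqrt s).
  rewrite sqrtr_gt0 => /(_ s0).
  rewrite euclidean_ballE ?sqrtr_gt0// sqr_sqrtr ?ltW// => E.
  exact: (esym (congr1 fine E)).
apply: le_trans (le_normr_Rintegral mC (intP 2 s)) _.
rewrite -RintegralZl//; apply: le_Rintegral => //.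
- by have := integrable_abse (intP 2 s).
- exact: integrable_scale.
move=> z Cz; rewrite normrM normrX (ger0_norm (pp_ge0 s z)).
have [zB|zB] := pselect (B s z).
  rewrite mem_set// mulr1; apply: ler_pM => //; last exact: he.
    exact: exprn_ge0.
  by apply: lerXn2r; rewrite ?nnegrE// ?(ltW s0)//; have := pp_le s z; rewrite gtr0_norm.
rewrite memNset// mulr0 /pp max_r ?expr0n ?mul0r//.
by rewrite subr_le0 leNgt; apply/negP.
Qed.

Let small_near (e : R) : 0 < e -> exists s : R, [/\ 0 < s, s <= T &
  forall z, B s z -> `|h z| <= e].
Proof.
move=> e0; have Dx0 : D x0.
  by apply: CD; rewrite /C /= /rho subrr /sqnorm big1 ?ltW// => i _; rewrite mxE expr0n.
have [ch _ _ _ _] := hD.1 x0 Dx0.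
move/cvgrPdist_lt : ch => /(_ e e0) /nbhs_ballP[r /= r0 rP].
(* [B s] bounds the squared norm, hence [r ^+ 2]; each coordinate is then below [r], which is the
   sup-norm ball given by continuity. *)
exists (Num.min T (r ^+ 2)); split.
- by rewrite lt_min T0 exprn_gt0.
- by rewrite ge_min lexx.
move=> z; rewrite /B /= lt_min => /andP[_ zr].
have := rP z; rewrite hx0 sub0r normrN => zP; apply/ltW/zP.
split=> // i j; rewrite (ord1 i) /ball /= distrC.
rewrite -[ltRHS]ger0_norm ?ltW// -ltr_sqr ?nnegrE// !real_normK ?num_real//.
have := sqr_coord_le (z - x0) j; rewrite !mxE => h1; exact: le_lt_trans h1 zr.
Qed.

Let G_le (e : R) : 0 < e -> G T <= (e * unit_ball_volume R N) ^+ 2.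
Proof.
move=> e0; have [s [s0 sT he]] := small_near e0.
rewrite -(G_cst s0 sT) /G ler_pdivrMr ?exprn_gt0//.
rewrite -[X in X <= _]real_normK ?num_real//.
apply: le_trans (_ : _ <= (s ^+ 2 * e * (unit_ball_volume R N * Num.sqrt s ^+ N)) ^+ 2) _.
  apply: lerXn2r; rewrite ?nnegrE//.
    have := unit_ball_volume_gt0 R N => u0.
    by rewrite !mulr_ge0// ?exprn_ge0 ?sqrtr_ge0 ?ltW.
  exact: P2_le.
rewrite le_eqVlt; apply/orP; left; apply/eqP.
rewrite !exprMn exprAC sqr_sqrtr ?ltW// exprD; ring.
Qed.

Let P2_eq0 (s : R) : 0 < s -> s <= T -> P 2 s = 0.
Proof.
move=> s0 sT.
have GT : G T <= 0.
  have u0 := unit_ball_volume_gt0 R N.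
  rewrite leNgt; apply/negP => G0.
  have sG0 : 0 < Num.sqrt (G T) by rewrite sqrtr_gt0.
  (* With this choice of [e] the bound reads [G T <= G T / 4], impossible for a positive [G T]. *)
  have := @G_le (Num.sqrt (G T) / (2 * unit_ball_volume R N)).
  rewrite divr_gt0 ?mulr_gt0// => /(_ isT).
  have -> : Num.sqrt (G T) / (2 * unit_ball_volume R N) * unit_ball_volume R N =
    Num.sqrt (G T) / 2 by field; rewrite gt_eqF.
  have -> : (Num.sqrt (G T) / 2) ^+ 2 = Num.sqrt (G T) ^+ 2 / 4 by field.
  rewrite sqr_sqrtr ?(ltW G0)//; lra.
have : P 2 s ^+ 2 <= 0.
  by move: GT; rewrite -(G_cst s0 sT) /G pmulr_lle0// invr_gt0 exprn_gt0.
move=> h1; apply/eqP; rewrite -sqrf_eq0 eq_le h1; exact: sqr_ge0.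
Qed.

Let P1_eq0 (s : R) : 0 < s -> s <= T -> P 1 s = 0.
Proof.
move=> s0 sT; have := P12 s0 sT; rewrite P2_eq0// mulr0 => /eqP.
by rewrite !mulf_eq0 pnatr_eq0 (gt_eqF s0)/= => /eqP.
Qed.

(** It approaches [T] from below, since [P 1] is known to vanish only up to [T]. The shift by 2
    makes the first term [T / 2], still positive. *)
Let s_ (j : nat) : R := T - T / j.+2%:R.

Let s_bounds j : 0 < s_ j <= T.
Proof.
have j0 : 0 < j.+2%:R :> R by [].
rewrite /s_ subr_gt0 gerBl ltr_pdivrMr// ltr_pMr// ltr1n /=.
by rewrite divr_ge0// ltW.
Qed.

Lemma harmonic_integral_eq0 : (\int[lam R N]_(z in B T) (h z)%:E = 0)%E.
Proof.
(* Left difference quotients at [T] of the integrand of [P 1], with step [T / (j + 2)]. They are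
   dominated by [|h|]; at a point of the open ball they are eventually equal to [h], and on the
   sphere both positive parts vanish. *)
pose f_ j z := j.+2%:R / T * (pp T z ^+ 1 * h z - pp (s_ j) z ^+ 1 * h z).
pose f z := h z * \1_(B T : set (lebesgue_space R N)) z.
have [M M0 hM] := hbound.
have inth : (lam R N).-integrable C (EFin \o h) by exact: (bounded_integrable mh hM).
have intnh : (lam R N).-integrable C (EFin \o (fun z => `|h z|)).
  by have := integrable_abse inth.
have intf_ j : (lam R N).-integrable C (EFin \o f_ j).
  by apply: integrable_scale => //; exact: integrable_sub.
have f_0 j : (\int[lam R N]_(z in C) (f_ j z)%:E = 0)%E.
  have /andP[sj0 sjT] := s_bounds j.
  have : Rintegral (lam R N) C (f_ j) = 0.
    rewrite RintegralZl//; last exact: integrable_sub.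
    by rewrite RintegralB// -/(P 1 T) -/(P 1 (s_ j)) !P1_eq0// subrr mulr0.
  move=> h0; rewrite -[LHS]fineK; first exact: (congr1 EFin h0).
  by apply: integrable_fin_num => //; exact: intf_.
have TB z : C z -> pp T z = T - rho z by move=> Cz; rewrite /pp max_l// subr_ge0.
have f_le j z : C z -> `|f_ j z| <= `|h z|.
  move=> Cz; rewrite /f_ !expr1 -mulrBl mulrA normrM -[leRHS]mul1r ler_wpM2r//.
  have j0 : 0 < j.+2%:R :> R by [].
  rewrite normrM gtr0_norm ?divr_gt0// -ler_pdivlMl ?divr_gt0// mulr1 invf_div.
  have Tj0 : 0 <= T / j.+2%:R by rewrite divr_ge0// ltW.
  rewrite TB// /pp /s_ ler_norml; rewrite /C /= in Cz.
  move: (T / j.+2%:R) Tj0 => a a0.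
  by case: (leP (T - a - rho z) 0) => ?; apply/andP; split; lra.
have f_cvg z : C z -> f_ j z @[j --> \oo] --> f z.
  move=> Cz; have [zT|zT] := ltP (rho z) T.
    apply: cvg_near_cst; near=> j.
    have Tz : 0 < T - rho z by rewrite subr_gt0.
    have jT : (Num.truncn (T / (T - rho z)) <= j)%N by near: j; exact: nbhs_infty_ge.
    have j0 : 0 < j.+2%:R :> R by [].
    have sz : T / j.+2%:R <= T - rho z.
      rewrite ler_pdivrMr// mulrC -ler_pdivrMr//.
      apply: ltW; apply: lt_le_trans (truncnS_gt _) _.
      by rewrite ler_nat ltnS leqW.
    have ppE : pp (s_ j) z = T - T / j.+2%:R - rho z.
      by rewrite /pp max_l// /s_ addrAC subr_ge0.
    rewrite /f_ /f indicE mem_set// mulr1 TB// ppE.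
    by move: (j.+2%:R) j0 {sz ppE} => a a0; field; rewrite !gt_eqF.
  rewrite (_ : (fun j => _) = cst (f z)); first exact: cvg_cst.
  apply/funext => j; rewrite /f /f_ indicE memNset; last by rewrite /B /= ltNge zT.
  rewrite TB// /pp max_r; last first.
    by have /andP[_ ?] := s_bounds j; rewrite subr_le0; exact: le_trans zT.
  rewrite /C /= in Cz; have -> : rho z = T by apply/eqP; rewrite eq_le Cz.
  by rewrite /=; ring.
have mf_ j : measurable_fun (C : set (lebesgue_space R N)) (f_ j : lebesgue_space R N -> R).
  by apply/measurable_EFinP; exact: measurable_int (intf_ j).
have [_ lim] := dominated_convergence_real mC mf_ f_cvg intnh f_le.
have : (\int[lam R N]_(z in C) (f z)%:E = 0)%E.
  rewrite -(cvg_lim _ lim)//.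
  rewrite (_ : (fun j => _) = cst 0%E); last by apply/funext => j; exact: f_0.
  exact: lim_cst.
move=> <-; rewrite [LHS]integral_mkcond [RHS]integral_mkcond.
apply: eq_integral => z _; rewrite !patchE /f indicE.
have [zB|zB] := pselect (B T z).
  by rewrite !mem_set ?mulr1// /C /=; exact: ltW.
by rewrite (memNset zB) mulr0; case: ifP.
Unshelve. all: by end_near. Qed.

End harmonic_mean_value.

Lemma harmonic_mean_value (R : realType) (N : nat) (D : set 'rV[R]_N)
    (h : 'rV[R]_N -> R) (x0 : 'rV[R]_N) (r : R) :
  open D -> harmonic_on D h -> 0 < r -> closed_euclidean_ball x0 r `<=` D ->
  (lam R N).-integrable (euclidean_ball x0 r) (EFin \o h) /\
  (\int[lam R N]_(z in euclidean_ball x0 r) (h z)%:E =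
   (h x0)%:E * lam R N (euclidean_ball x0 r))%E.
Proof.
move=> oD hD r0; rewrite closed_euclidean_ballE// => CD.
have T0 : 0 < r ^+ 2 by rewrite exprn_gt0.
have mB := euclidean_ball_measurable x0 r0.
have Boo : (lam R N (euclidean_ball x0 r) < +oo)%E.
  by rewrite [lam R N _]euclidean_ball_volume// ltry.
have BC : euclidean_ball x0 r `<=` [set z | sqnorm (z - x0) <= r ^+ 2].
  by rewrite euclidean_ballE// => z /ltW.
have inth : (lam R N).-integrable (euclidean_ball x0 r) (EFin \o h).
  have [M M0 hM] : exists2 M : R, 0 <= M &
      forall z, [set z | sqnorm (z - x0) <= r ^+ 2] z -> `|h z| <= M.
    apply: continuous_compact_bounded; first exact: compact_sqnorm_le.
    by move=> z /CD /hD.1 [].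
  apply: measurable_bounded_integrable => //.
    apply: continuous_measurable_on_open; first exact: open_euclidean_ball.
    by move=> x /BC /CD /hD.1 [].
  exists M; split => [|x xM z Bz]; first exact: num_real.
  by apply: le_trans (hM z (BC _ Bz)) (ltW xM).
split=> //.
(* The integral was shown to vanish for harmonic functions that are 0 at the center; subtracting a
   constant reduces to that case. *)
pose g z := h z - h x0.
have partial_g i : partial i g = partial i h.
  apply/funext => z; rewrite /partial /derive.
  rewrite (_ : (fun s : R => s^-1 *: ((g \o shift z) (s *: delta_mx 0 i) - g z)) =
    (fun s : R => s^-1 *: ((h \o shift z) (s *: delta_mx 0 i) - h z)))//.
  by apply/funext => s; congr (_ *: _); rewrite /g /=; ring.
have gD : harmonic_on D g.
  split=> [x Dx|x Dx]; last first.
    rewrite -(hD.2 x Dx); apply: eq_bigr => i _; by rewrite partial_g.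
  have [ch dh pch ddh ddch] := hD.1 x Dx; split.
  - by apply: continuousB => //; exact: cst_continuous.
  - by move=> i; apply: derivableB => //; exact: derivable_cst.
  - by move=> i; rewrite partial_g.
  - by move=> i j; rewrite partial_g.
  - by move=> i j; rewrite !partial_g.
have := harmonic_integral_eq0 oD gD T0 (subrr _) CD.
rewrite -euclidean_ballE// => g0.
have iC : (lam R N).-integrable (euclidean_ball x0 r) (EFin \o cst (h x0)).
  apply: measurable_bounded_integrable => //.
  exists `|h x0|; split => [|x xM z Bz]; first exact: num_real.
  exact: ltW.
rewrite (_ : (fun z => _) = (fun z => ((EFin \o g) z + (EFin \o cst (h x0)) z)%E)).
  rewrite integralD//; last exact: integrable_sub.
  rewrite [X in (X + _)%E]g0 add0e.
  exact: (integral_cst (lam R N) mB (h x0)%:E).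
by apply/funext => z; rewrite /= -EFinD /g subrK.
Qed.

(** * Measurability of separately measurable and continuous functions *)

Lemma open_has_rat_row (R : realType) (N : nat) (U : set 'rV[R]_N)
    (y : 'rV[R]_N) : nbhs y U ->
  exists q : 'rV[rat]_N, U (map_mx ratr q).
Proof.
rewrite nbhsE => -[V [oV Vy] VU].
move: (Vy); rewrite (open_rat_boxes oV) => -[[p q] /= pqV ypq].
exists q; apply/VU/pqV => i; have /andP[h1 h2] := ypq i.
by rewrite lexx andbT (lt_le_trans h1).
Qed.

(** The topology is defined by the sup norm; this describes it by Euclidean balls, which behave well
    under [row_mx]. *)
Lemma nbhs_sqnorm (R : realType) (N : nat) (y : 'rV[R]_N) (U : set 'rV[R]_N) :
  nbhs y U <-> exists2 e : R, 0 < e & [set z | sqnorm (z - y) < e] `<=` U.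
Proof.
split=> [/nbhs_ballP[e /= e0 yeU]|[e e0 eU]].
  exists (e ^+ 2); first by rewrite exprn_gt0.
  move=> z /= ze; apply: yeU; split=> // i j; rewrite (ord1 i) /ball /= distrC.
  rewrite -[ltRHS]ger0_norm ?ltW// -ltr_sqr ?nnegrE// !real_normK ?num_real//.
  by have := sqr_coord_le (z - y) j; rewrite !mxE => h1; exact: le_lt_trans h1 ze.
apply: filterS eU _; apply: open_nbhs_nbhs; split; first exact: open_sqnorm_lt.
by rewrite /= subrr /sqnorm big1// => i _; rewrite mxE expr0n.
Qed.

Lemma sqnorm_row_mx (R : realType) (m n : nat) (x : 'rV[R]_m) (y : 'rV[R]_n) :
  sqnorm (row_mx x y) = sqnorm x + sqnorm y.
Proof.
rewrite /sqnorm big_split_ord; congr (_ + _); apply: eq_bigr => i _.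
  by rewrite row_mxEl.
by rewrite row_mxEr.
Qed.

Lemma sqnorm_row_mxB (R : realType) (m n : nat) (x x0 : 'rV[R]_m)
    (y y0 : 'rV[R]_n) :
  sqnorm (row_mx x y - row_mx x0 y0) = sqnorm (x - x0) + sqnorm (y - y0).
Proof. by rewrite opp_row_mx add_row_mx sqnorm_row_mx. Qed.

Lemma sqnorm0 (R : realType) (N : nat) : sqnorm (0 : 'rV[R]_N) = 0.
Proof. by rewrite /sqnorm big1// => i _; rewrite mxE expr0n. Qed.

Lemma sqnormBC (R : realType) (N : nat) (x y : 'rV[R]_N) :
  sqnorm (x - y) = sqnorm (y - x).
Proof. by apply: eq_bigr => i _; rewrite !mxE -sqrrN opprB. Qed.

Lemma open_x_section (R : realType) (m n : nat) (Omega : set 'rV[R]_(m + n))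
  (y : 'rV[R]_n) : open Omega -> open (x_section Omega y).
Proof.
move=> oO; rewrite openE => x Ox.
have /nbhs_sqnorm[e e0 eO] := open_nbhs_nbhs (conj oO Ox).
apply/nbhs_sqnorm; exists e => // z ze; apply: eO => /=.
by rewrite sqnorm_row_mxB subrr sqnorm0 addr0.
Qed.

Lemma open_y_section (R : realType) (m n : nat) (Omega : set 'rV[R]_(m + n))
  (x : 'rV[R]_m) : open Omega -> open (y_section Omega x).
Proof.
move=> oO; rewrite openE => y Oy.
have /nbhs_sqnorm[e e0 eO] := open_nbhs_nbhs (conj oO Oy).
apply/nbhs_sqnorm; exists e => // z ze; apply: eO => /=.
by rewrite sqnorm_row_mxB subrr sqnorm0 add0r.
Qed.

(** Each rational box is a product of two boxes, and there are countably many of them, so [U] lies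
    in the product sigma-algebra itself and not merely in its completion. *)
Lemma measurable_setX_open (R : realType) (m n : nat)
    (U : set 'rV[R]_(m + n)) : open U ->
  measurable ([set p | U (row_mx p.1 p.2)] :
    set (lebesgue_space R m * lebesgue_space R n)).
Proof.
move=> oU; rewrite [X in [set p | X _]](open_rat_boxes oU).
rewrite (_ : [set p | _] = \bigcup_(pq in [set pq : 'rV[rat]_(m + n) * 'rV[rat]_(m + n) |
       box (map_mx ratr pq.1) (map_mx ratr pq.2) `<=` U])
    [set p | box (map_mx ratr pq.1) (map_mx ratr pq.2) (row_mx p.1 p.2)]); last first.
  by apply/seteqP; split=> p.
rewrite bigcup_mkcond; apply: countable_bigcupT_measurable; first exact: countableP.
move=> pq; case: ifP => _; last exact: measurable0.
rewrite box_row_mx.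
rewrite (_ : [set p | _] =
  box (lsubmx (map_mx ratr pq.1)) (lsubmx (map_mx ratr pq.2)) `*`
  box (rsubmx (map_mx ratr pq.1)) (rsubmx (map_mx ratr pq.2))).
  by apply: measurableX; exact: lebesgue_measurable_box.
by apply/seteqP; split=> p; rewrite /row_setX /= row_mxKl row_mxKr.
Qed.

(* [u x y > a] holds iff, for some p and k, every rational [q] with
   [sqnorm (q - y) < 1/k] satisfies [u x q >= a + 1/p]. *)
Lemma measurable_caratheodory_function (R : realType) (m n : nat)
    (Omega : set 'rV[R]_(m + n)) (u : 'rV[R]_(m + n) -> R) :
  open Omega ->
  (forall y, measurable_fun (x_section Omega y : set (lebesgue_space R m))
     ((fun x => u (row_mx x y)) : lebesgue_space R m -> R)) ->
  (forall x y, Omega (row_mx x y) -> {for y, continuous (fun y => u (row_mx x y))}) ->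
  measurable_fun ([set p | Omega (row_mx p.1 p.2)] :
      set (lebesgue_space R m * lebesgue_space R n))
    (fun p => u (row_mx p.1 p.2)).
Proof.
move=> oO mu cu; apply: (measurability _ (RGenOInfty.measurableE R)) => _ [_ [a ->] <-].
set W := [set p | Omega _].
pose rq (q : 'rV[rat]_n) : 'rV[R]_n := map_mx ratr q.
(* Rows [q] outside the section at [x] impose no condition, since the values of [u] there are
   arbitrary. Read as a disjunction, the two implications make [S i k q] a union of three
   rectangles. *)
pose S (i k : nat) (q : 'rV[rat]_n) : set (lebesgue_space R m * lebesgue_space R n) :=
  [set p | sqnorm (p.2 - rq q) < k.+1%:R^-1 -> Omega (row_mx p.1 (rq q)) ->
     a + i.+1%:R^-1 <= u (row_mx p.1 (rq q))].
have mS i k q : measurable (S i k q).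
  rewrite (_ : S i k q = (setT `*` ~` [set y | sqnorm (y - rq q) < k.+1%:R^-1]) `|`
    (~` (x_section Omega (rq q)) `*` setT) `|`
    ((x_section Omega (rq q) `&`
      (fun x => u (row_mx x (rq q))) @^-1` `[a + i.+1%:R^-1, +oo[) `*` setT)).
    apply: measurableU; first apply: measurableU.
    - apply: measurableX; first exact: measurableT.
      by apply: measurableC; apply: lebesgue_measurable_open; exact: open_sqnorm_lt.
    - apply: measurableX; last exact: measurableT.
      by apply: measurableC; apply: lebesgue_measurable_open; exact: open_x_section.
    - apply: measurableX; last exact: measurableT.
      apply: mu; last exact: measurable_itv.
      by apply: lebesgue_measurable_open; exact: open_x_section.
  apply/seteqP; split=> -[x y]; rewrite /S /x_section /=.
    move=> h.
    have [h1|h1] := pselect (sqnorm (y - rq q) < k.+1%:R^-1); last by left; left.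
    have [h2|h2] := pselect (Omega (row_mx x (rq q))); last by left; right.
    by right; split=> //; split=> //; rewrite in_itv /= andbT; exact: h.
  by move=> [[[_ h]//|[h _]//]|[[_]]]; rewrite in_itv /= andbT.
rewrite (_ : _ `&` _ = W `&` \bigcup_i \bigcup_k \bigcap_q S i k q).
  apply: measurableI; first exact: measurable_setX_open.
  apply: bigcupT_measurable => i; apply: bigcupT_measurable => k.
  rewrite -[X in measurable X]setCK setC_bigcap; apply: measurableC.
  apply: countable_bigcupT_measurable; first exact: countableP.
  by move=> q; apply: measurableC.
apply/seteqP; split=> -[x y] [Wxy /=].
  rewrite in_itv /= andbT => auxy; split=> //.
  have [i ai] := ltr_add_invr auxy.
  have : nbhs y [set q | a + i.+1%:R^-1 < u (row_mx x q)].
    exact: (cvgr_gt _ (cu x y Wxy)).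
  move=> /nbhs_sqnorm[e e0 eP].
  have [k] := ltr_add_invr e0; rewrite add0r => ke.
  exists i => //; exists k => // q _ /= yq Oq.
  by apply/ltW/eP; rewrite /= sqnormBC; exact: lt_trans ke.
(* If [u] were at most [a] at the point, continuity in [y], openness of the section and density of
   rational rows would give an admissible [q] with a value below [a + 1 / (i + 1)], against
   [S i k q]. *)
move=> [i _ [k _ Sq]]; split=> //=; rewrite in_itv /= andbT ltNge; apply/negP => ua.
have i0 : 0 < i.+1%:R^-1 :> R by rewrite invr_gt0.
have n1 : nbhs y [set q | u (row_mx x q) < a + i.+1%:R^-1].
  by apply: (cvgr_lt _ (cu x y Wxy)); apply: le_lt_trans ua _; rewrite ltrDl.
have n2 : nbhs y (y_section Omega x).
  by apply: open_nbhs_nbhs; split => //; exact: open_y_section.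
have n3 : nbhs y [set q | sqnorm (q - y) < k.+1%:R^-1].
  by apply/nbhs_sqnorm; exists k.+1%:R^-1 => //; rewrite invr_gt0.
have [q [[q1 q2] q3]] := open_has_rat_row (filterI (filterI n1 n2) n3).
have := Sq q I; rewrite /S /= sqnormBC => /(_ q3 q2).
by rewrite leNgt q1.
Qed.

(** * Separately quasinearly subharmonic and harmonic functions *)

Lemma integral_extend0 d (T : measurableType d) (R : realType)
    (mu : {measure set T -> \bar R}) (B : set T) (f g : T -> R) :
  (forall x, B x -> g x = f x) -> (forall x, ~ B x -> g x = 0) ->
  (\int[mu]_x (g x)%:E = \int[mu]_(x in B) (f x)%:E)%E.
Proof.
move=> gB gN; rewrite [RHS]integral_mkcond; apply: eq_integral => x _.
rewrite patchE; have [Bx|Bx] := pselect (B x); first by rewrite mem_set// gB.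
by rewrite memNset// gN.
Qed.

Lemma ge0_integral_setU_lty d (T : measurableType d) (R : realType)
    (mu : {measure set T -> \bar R}) (A B : set T) (f : T -> \bar R) :
  measurable A -> measurable B -> measurable_fun (A `|` B) f ->
  (forall x, (0 <= f x)%E) ->
  (\int[mu]_(x in A) f x < +oo)%E -> (\int[mu]_(x in B) f x < +oo)%E ->
  (\int[mu]_(x in A `|` B) f x < +oo)%E.
Proof.
move=> mA mB mf f0 Aoo Boo.
have mBA : measurable (B `\` A) by exact: measurableD.
have AB : A `|` B = A `|` (B `\` A) by rewrite setUDr setDv setD0.
rewrite AB ge0_integral_setU//; last 2 first.
- by rewrite -AB.
- by apply/disj_setPS => x [Ax [_]].
apply: lte_add_pinfty => //; apply: le_lt_trans Boo.
apply: ge0_subset_integral => //.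
by apply: measurable_funS mf; [exact: measurableU|move=> x; right].
Qed.

Lemma le_integral_row_mx (R : realType) (m n : nat)
    (f g : 'rV[R]_(m + n) -> \bar R) :
  measurable_fun (setT : set (lebesgue_space R m * lebesgue_space R n))
    (fun p => f (row_mx p.1 p.2)) ->
  measurable_fun (setT : set (lebesgue_space R m * lebesgue_space R n))
    (fun p => g (row_mx p.1 p.2)) ->
  (forall z, (0 <= f z)%E) -> (forall z, (0 <= g z)%E) ->
  (forall x, (\int[lam R n]_y f (row_mx x y) <= \int[lam R n]_y g (row_mx x y))%E) ->
  (\int[lam R (m + n)]_z f z <= \int[lam R (m + n)]_z g z)%E.
Proof.
move=> mf mg f0 g0 fg; rewrite (integral_row_mx mf)// (integral_row_mx mg)//.
apply: ge0_le_integral.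
- exact: measurableT.
- by move=> x _; apply: integral_ge0.
- exact: (measurable_fun_fubini_tonelli_F (m2 := lam R n) _ mf).
- exact: (measurable_fun_fubini_tonelli_F (m2 := lam R n) _ mg).
- by move=> x _; exact: fg.
Qed.

Lemma le_integral_row_mx_swap (R : realType) (m n : nat)
    (f g : 'rV[R]_(m + n) -> \bar R) :
  measurable_fun (setT : set (lebesgue_space R m * lebesgue_space R n))
    (fun p => f (row_mx p.1 p.2)) ->
  measurable_fun (setT : set (lebesgue_space R m * lebesgue_space R n))
    (fun p => g (row_mx p.1 p.2)) ->
  (forall z, (0 <= f z)%E) -> (forall z, (0 <= g z)%E) ->
  (forall y, (\int[lam R m]_x f (row_mx x y) <= \int[lam R m]_x g (row_mx x y))%E) ->
  (\int[lam R (m + n)]_z f z <= \int[lam R (m + n)]_z g z)%E.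
Proof.
move=> mf mg f0 g0 fg.
rewrite (integral_row_mx_swap mf)// (integral_row_mx_swap mg)//.
apply: ge0_le_integral.
- exact: measurableT.
- by move=> x _; apply: integral_ge0.
- exact: (measurable_fun_fubini_tonelli_G (m1 := lam R m) _ mf).
- exact: (measurable_fun_fubini_tonelli_G (m1 := lam R m) _ mg).
- by move=> x _; exact: fg.
Qed.

Lemma euclidean_ball_y_section (R : realType) (m n : nat) (x x0 : 'rV[R]_m)
    (y0 : 'rV[R]_n) (r : R) : 0 < r -> sqnorm (x - x0) < r ^+ 2 ->
  [set y | euclidean_ball (row_mx x0 y0) r (row_mx x y)] =
  euclidean_ball y0 (Num.sqrt (r ^+ 2 - sqnorm (x - x0))).
Proof.
move=> r0 xr; rewrite !euclidean_ballE ?sqrtr_gt0 ?subr_gt0//.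
rewrite sqr_sqrtr ?subr_ge0 1?ltW//; apply/seteqP.
by split=> y /=; rewrite sqnorm_row_mxB ltrBrDl.
Qed.

Lemma euclidean_ball_x_section (R : realType) (m n : nat) (x0 : 'rV[R]_m)
    (y y0 : 'rV[R]_n) (r : R) : 0 < r -> sqnorm (y - y0) < r ^+ 2 ->
  [set x | euclidean_ball (row_mx x0 y0) r (row_mx x y)] =
  euclidean_ball x0 (Num.sqrt (r ^+ 2 - sqnorm (y - y0))).
Proof.
move=> r0 yr; rewrite !euclidean_ballE ?sqrtr_gt0 ?subr_gt0//.
rewrite sqr_sqrtr ?subr_ge0 1?ltW//; apply/seteqP.
by split=> x /=; rewrite sqnorm_row_mxB ltrBrDr.
Qed.

Lemma truncationE (R : realType) (T : Type) (u : T -> R) (M : R) (z : T) :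
  truncation (fun z => (u z)%:E) M z = (Num.max (u z) (- M) + M)%:E.
Proof. by rewrite /truncation -EFin_max -EFinD. Qed.

Lemma trunc_ge0 (R : realType) (a M : R) : 0 <= Num.max a (- M) + M.
Proof. by rewrite -lerBlDr sub0r le_max lexx orbT. Qed.

Lemma max0_decomp (R : realFieldType) (a : R) :
  Num.max a 0 = a + Num.max (- a) 0.
Proof. by case: (leP a 0) => ?; case: (leP (- a) 0) => ?; lra. Qed.

(** If [h x0 <= - M] the left side is 0. Otherwise it is the integral of [h + M] by the mean value
    property, and the truncation dominates [h + M] pointwise. *)
Lemma harmonic_trunc_mean_le (R : realType) (N : nat) (D : set 'rV[R]_N)
    (h : 'rV[R]_N -> R) (x0 : 'rV[R]_N) (r M : R) :
  open D -> harmonic_on D h -> 0 < r -> closed_euclidean_ball x0 r `<=` D ->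
  ((Num.max (h x0) (- M) + M)%:E * lam R N (euclidean_ball x0 r) <=
   \int[lam R N]_(z in euclidean_ball x0 r) (Num.max (h z) (- M) + M)%:E)%E.
Proof.
move=> oD hD r0 CD.
have int0 : (0 <= \int[lam R N]_(z in euclidean_ball x0 r)
    (Num.max (h z) (- M) + M)%:E)%E.
  by apply: integral_ge0 => z _; rewrite lee_fin trunc_ge0.
have [hM|hM] := leP (h x0) (- M); first by rewrite addNr mul0e.
have mB := euclidean_ball_measurable x0 r0.
have Boo : (lam R N (euclidean_ball x0 r) < +oo)%E.
  by rewrite [lam R N _]euclidean_ball_volume// ltry.
have [inth hE] := harmonic_mean_value oD hD r0 CD.
have intM : (lam R N).-integrable (euclidean_ball x0 r) (EFin \o cst M).
  apply: measurable_bounded_integrable => //.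
  exists `|M|; split => [|x xM z Bz]; first exact: num_real.
  exact: ltW.
have inthM := integrableD mB inth intM.
have intT : (lam R N).-integrable (euclidean_ball x0 r)
    (EFin \o (fun z => Num.max (h z) (- M) + M)).
  apply: le_integrable inthM => //.
    apply/measurable_EFinP; apply: measurable_funD; last exact: measurable_cst.
    apply: measurable_maxr; last exact: measurable_cst.
    by apply/measurable_EFinP; exact: measurable_int inth.
  move=> z _ /=; rewrite lee_fin ger0_norm ?trunc_ge0//.
  case: (leP (h z) (- M)) => _; last exact: ler_norm.
  by rewrite addNr.
apply: (@le_trans _ _ (\int[lam R N]_(z in euclidean_ball x0 r)
    ((EFin \o h) z + (EFin \o cst M) z))%E).
  rewrite integralD// hE [X in (_ + X)%E](integral_cst (lam R N) mB M%:E).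
  have key (x : \bar R) : x \is a fin_num ->
      ((h x0 + M)%:E * x <= (h x0)%:E * x + M%:E * x)%E.
    by move/fineK <-; rewrite -!EFinM -EFinD mulrDl.
  by apply: key; rewrite ge0_fin_numE ?measure_ge0.
apply: le_integral => // z _; rewrite /= lee_fin lerD2r le_max lexx//.
Qed.

Lemma measurable_row_mx_extend0 (R : realType) (m n : nat)
    (S : set 'rV[R]_(m + n)) (f : lebesgue_space R m * lebesgue_space R n -> R)
    (g : 'rV[R]_(m + n) -> R) :
  measurable ([set p | S (row_mx p.1 p.2)] :
    set (lebesgue_space R m * lebesgue_space R n)) ->
  measurable_fun ([set p | S (row_mx p.1 p.2)] :
    set (lebesgue_space R m * lebesgue_space R n)) f ->
  (forall x y, S (row_mx x y) -> g (row_mx x y) = f (x, y)) ->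
  (forall z, ~ S z -> g z = 0) ->
  measurable_fun (setT : set (lebesgue_space R m * lebesgue_space R n))
    (fun p => (g (row_mx p.1 p.2))%:E).
Proof.
move=> mS mf gS gN; apply/measurable_EFinP.
apply: (measurable_fun_extend0 mS mf).
  by move=> [x y] /gS.
by move=> p /gN.
Qed.

Section separately_harmonic.
Variables (R : realType) (m n : nat) (Omega : set 'rV[R]_(m + n)) (K : R).
Variables (u : 'rV[R]_(m + n) -> R).
Hypothesis oO : open Omega.
Hypothesis ha : forall y : 'rV[R]_n,
  quasinearly_subharmonic K (x_section Omega y) (fun x => (u (row_mx x y))%:E).
Hypothesis hb : forall x : 'rV[R]_m,
  harmonic_on (y_section Omega x) (fun y => u (row_mx x y)).

Local Notation space2 := (lebesgue_space R m * lebesgue_space R n)%type.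

Let mux y : measurable_fun (x_section Omega y : set (lebesgue_space R m))
  ((fun x => u (row_mx x y)) : lebesgue_space R m -> R).
Proof. by apply/measurable_EFinP; have [] := ha y. Qed.

Let mux_sub y (B : set (lebesgue_space R m)) : B `<=` x_section Omega y ->
  measurable_fun B ((fun x => u (row_mx x y)) : lebesgue_space R m -> R).
Proof.
move=> BO; apply: (@measurable_funS _ _ _ _ (x_section Omega y : set (lebesgue_space R m))) => //.
by apply: lebesgue_measurable_open; exact: open_x_section.
Qed.

Let mu2 : measurable_fun ([set p | Omega (row_mx p.1 p.2)] : set space2)
  (fun p => u (row_mx p.1 p.2)).
Proof.
apply: measurable_caratheodory_function => // x y Oxy.
by have [] := (hb x).1 y Oxy.
Qed.

Lemma separately_harmonic_measurable :
  lebesgue_measurable_fun Omega (fun z => (u z)%:E).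
Proof.
apply/measurable_EFinP => mO Y mY.
have := @measurable_row_split R m n measurableT _
  (mu2 (measurable_setX_open oO) mY).
rewrite setTI (_ : _ @^-1` _ = Omega `&` u @^-1` Y)//.
by apply/seteqP; split=> z /=; rewrite hsubmxK.
Qed.

(* Tonelli is used twice: first the values [v (x, y)] are replaced by the smaller
   averages [v (x, y0)] on the slices in [y], then [v (x, y0)] by [v (x0, y0) / K]
   on the slices in [x]. *)
Lemma separately_harmonic_mean_le (M : R) (z0 : 'rV[R]_(m + n)) (r : R) :
  0 < K -> 0 <= M -> 0 < r -> closed_euclidean_ball z0 r `<=` Omega ->
  ((Num.max (u z0) (- M) + M)%:E * lam R (m + n) (euclidean_ball z0 r) <=
   K%:E * \int[lam R (m + n)]_(z in euclidean_ball z0 r)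
            (Num.max (u z) (- M) + M)%:E)%E.
Proof.
rewrite -(hsubmxK z0); move: (lsubmx z0) (rsubmx z0) => {}x0 y0 K0 M0 r0 BO.
set z0' := row_mx x0 y0 in BO *.
set B := euclidean_ball z0' r.
have BE : B = [set z | sqnorm (z - z0') < r ^+ 2] by exact: euclidean_ballE.
have oB : open B by exact: open_euclidean_ball.
have BsubO z : sqnorm (z - z0') <= r ^+ 2 -> Omega z.
  by move=> zr; apply: BO; rewrite closed_euclidean_ballE.
have BO' : B `<=` Omega by move=> z; rewrite BE => /ltW /BsubO.
pose v (z : 'rV[R]_(m + n)) : R := Num.max (u z) (- M) + M.
have v0 z : 0 <= v z by exact: trunc_ge0.
pose c : R := v z0' / K.
have c0 : 0 <= c by rewrite divr_ge0// ltW.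
(* Extension by 0 off [B] lets Tonelli run over the whole space. The three functions are compared
   slice by slice: [wB] freezes [y] at [y0], and [cB] also freezes [x]. *)
pose vB z := if z \in B then v z else 0.
pose wB z := if z \in B then v (row_mx (lsubmx z) y0) else 0.
pose cB z := if z \in B then c else 0.
have B1 x y : B (row_mx x y) -> sqnorm (x - x0) < r ^+ 2.
  by rewrite BE /= sqnorm_row_mxB; have := sqnorm_ge0 (y - y0); lra.
have B2 x y : B (row_mx x y) -> sqnorm (y - y0) < r ^+ 2.
  by rewrite BE /= sqnorm_row_mxB; have := sqnorm_ge0 (x - x0); lra.
have mvB : measurable_fun (setT : set space2) (fun p => (vB (row_mx p.1 p.2))%:E).
  apply: (measurable_row_mx_extend0 (S := B) (f := fun p => v (row_mx p.1 p.2))).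
  - exact: measurable_setX_open.
  - apply: (@measurable_funS _ _ _ _ ([set p | Omega (row_mx p.1 p.2)] : set space2)).
    + exact: measurable_setX_open.
    + by move=> p /BO'.
    + apply: measurable_funD; last exact: measurable_cst.
      by apply: measurable_maxr; [exact: mu2|exact: measurable_cst].
  - by move=> x y xyB; rewrite /vB mem_set.
  - by move=> z zB; rewrite /vB memNset.
have mwB : measurable_fun (setT : set space2) (fun p => (wB (row_mx p.1 p.2))%:E).
  apply: (measurable_row_mx_extend0 (S := B) (f := fun p => v (row_mx p.1 y0))).
  - exact: measurable_setX_open.
  - have mv : measurable_fun (x_section Omega y0 : set (lebesgue_space R m))
        ((fun x => v (row_mx x y0)) : lebesgue_space R m -> R).
      apply: measurable_funD; last exact: measurable_cst.
      by apply: measurable_maxr; [exact: mux|exact: measurable_cst].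
    have mfst : measurable_fun ([set p | B (row_mx p.1 p.2)] : set space2)
        (fst : space2 -> lebesgue_space R m).
      by apply: measurable_funTS; exact: measurable_fst.
    apply: (measurable_comp _ _ mv mfst).
    + by apply: lebesgue_measurable_open; exact: open_x_section.
    + move=> _ [[x y] /= /B1 xB <-]; apply: BsubO.
      by rewrite sqnorm_row_mxB subrr sqnorm0 addr0 ltW.
  - by move=> x y xyB; rewrite /wB mem_set// row_mxKl.
  - by move=> z zB; rewrite /wB memNset.
have mcB : measurable_fun (setT : set space2) (fun p => (cB (row_mx p.1 p.2))%:E).
  apply: (measurable_row_mx_extend0 (S := B) (f := fun p => c)).
  - exact: measurable_setX_open.
  - exact: measurable_cst.
  - by move=> x y xyB; rewrite /cB mem_set.
  - by move=> z zB; rewrite /cB memNset.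
have vB0 z : (0 <= (vB z)%:E)%E by rewrite lee_fin /vB; case: ifP.
have wB0 z : (0 <= (wB z)%:E)%E by rewrite lee_fin /wB; case: ifP.
have cB0 z : (0 <= (cB z)%:E)%E by rewrite lee_fin /cB; case: ifP.
have le_wv : (\int[lam R (m + n)]_z (wB z)%:E <= \int[lam R (m + n)]_z (vB z)%:E)%E.
  apply: le_integral_row_mx => // x.
  have [xr|xr] := ltP (sqnorm (x - x0)) (r ^+ 2); last first.
    rewrite integral0_eq; first by apply: integral_ge0.
    by move=> y _; rewrite /wB memNset// => /B1; rewrite ltNge xr.
  set b := [set y | B (row_mx x y)].
  have bE : b = euclidean_ball y0 (Num.sqrt (r ^+ 2 - sqnorm (x - x0))).
    exact: euclidean_ball_y_section.
  rewrite (integral_extend0 (lam R n) (B := b) (f := cst (v (row_mx x y0)))); last 2 first.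
  - by move=> y yb; rewrite /wB mem_set// row_mxKl.
  - by move=> y yb; rewrite /wB memNset.
  rewrite (integral_extend0 (lam R n) (B := b) (f := fun y => v (row_mx x y))); last 2 first.
  - by move=> y yb; rewrite /vB mem_set.
  - by move=> y yb; rewrite /vB memNset.
  have s0 : 0 < Num.sqrt (r ^+ 2 - sqnorm (x - x0)) by rewrite sqrtr_gt0 subr_gt0.
  rewrite bE [leLHS](integral_cst (lam R n) (euclidean_ball_measurable y0 s0) (v (row_mx x y0))%:E).
  apply: (harmonic_trunc_mean_le M (open_y_section (x := x) oO) (hb x) s0).
  move=> y; rewrite closed_euclidean_ballE//= sqr_sqrtr ?subr_ge0 ?(ltW xr)// => yr.
  by apply: BsubO; rewrite sqnorm_row_mxB -lerBrDl.
have le_cw : (\int[lam R (m + n)]_z (cB z)%:E <= \int[lam R (m + n)]_z (wB z)%:E)%E.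
  apply: le_integral_row_mx_swap => // y.
  have [yr|yr] := ltP (sqnorm (y - y0)) (r ^+ 2); last first.
    rewrite integral0_eq; first by apply: integral_ge0.
    by move=> x _; rewrite /cB memNset// => /B2; rewrite ltNge yr.
  set b := [set x | B (row_mx x y)].
  have bE : b = euclidean_ball x0 (Num.sqrt (r ^+ 2 - sqnorm (y - y0))).
    exact: euclidean_ball_x_section.
  rewrite (integral_extend0 (lam R m) (B := b) (f := cst c)); last 2 first.
  - by move=> x xb; rewrite /cB mem_set.
  - by move=> x xb; rewrite /cB memNset.
  rewrite (integral_extend0 (lam R m) (B := b) (f := fun x => v (row_mx x y0))); last 2 first.
  - by move=> x xb; rewrite /wB mem_set// row_mxKl.
  - by move=> x xb; rewrite /wB memNset.
  set s := Num.sqrt _ in bE *.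
  have s0 : 0 < s by rewrite sqrtr_gt0 subr_gt0.
  rewrite bE [leLHS](integral_cst (lam R m) (euclidean_ball_measurable x0 s0) c%:E).
  have [_ _ _ /(_ M x0 s M0 s0)] := ha y0.
  (* Hypothesis (a) is always applied in the section at [y0]; the slice at [y] only determines the
     radius [s], and [s <= r] keeps the ball inside. *)
  have subO : closed_euclidean_ball x0 s `<=` x_section Omega y0.
    move=> x; rewrite closed_euclidean_ballE//= sqr_sqrtr ?subr_ge0 ?(ltW yr)// => xs.
    apply: BsubO; rewrite sqnorm_row_mxB subrr sqnorm0 addr0.
    by apply: le_trans xs _; rewrite gerBl sqnorm_ge0.
  move=> /(_ subO); rewrite truncationE => h1.
  have u0 := unit_ball_volume_gt0 R m.
  have b0 : 0 < unit_ball_volume R m * s ^+ m by rewrite mulr_gt0// exprn_gt0.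
  rewrite [X in (_ * X)%E](_ : _ = (unit_ball_volume R m * s ^+ m)%:E); last first.
    exact: euclidean_ball_volume.
  move: h1; rewrite -lee_pdivrMl ?divr_gt0//.
  rewrite (_ : truncation _ M = fun x => (v (row_mx x y0))%:E); last first.
    by apply/funext => x; exact: truncationE.
  rewrite invf_div -!EFinM (_ : _ / K * _ = c * (unit_ball_volume R m * s ^+ m)) => [//|].
  by rewrite /c /v; field; rewrite gt_eqF.
have cBE : (\int[lam R (m + n)]_z (cB z)%:E = c%:E * lam R (m + n) B)%E.
  rewrite (integral_extend0 (lam R (m + n)) (B := B) (f := cst c)); last 2 first.
  - by move=> x xb; rewrite /cB mem_set.
  - by move=> x xb; rewrite /cB memNset.
  exact: (integral_cst (lam R (m + n)) (euclidean_ball_measurable z0' r0) c%:E).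
have vBE : (\int[lam R (m + n)]_z (vB z)%:E = \int[lam R (m + n)]_(z in B) (v z)%:E)%E.
  apply: integral_extend0 => z zB; first by rewrite /vB mem_set.
  by rewrite /vB memNset.
have := le_trans le_cw le_wv; rewrite cBE vBE => cv.
rewrite (_ : Num.max _ _ + M = K * c); last by rewrite /c mulrC divfK// gt_eqF.
by rewrite EFinM -muleA; apply: lee_wpmul2l => //; rewrite lee_fin ltW.
Qed.

Variable phi : 'rV[R]_(m + n) -> \bar R.
Hypotheses (phiL : L1loc Omega phi) (phi0 : forall z, Omega z -> (0 <= phi z)%E).
Hypothesis phiu : forall z, Omega z -> (- phi z <= (u z)%:E)%E.

(** The estimate is made on a product [Q] of two balls: all its nonempty slices in [y] are the same
    ball [By], so the mean value property contributes one constant factor, the measure of [By]. *)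
Lemma separately_harmonic_locally_finite (z0 : 'rV[R]_(m + n)) : Omega z0 ->
  exists r : R, [/\ 0 < r, euclidean_ball z0 r `<=` Omega &
   (\int[lam R (m + n)]_(z in euclidean_ball z0 r) (Num.max (u z) 0)%:E < +oo)%E].
Proof.
move=> Oz0; have /nbhs_sqnorm[e e0 eO] := open_nbhs_nbhs (conj oO Oz0).
(* On [Q] the squared distance to the center is below [2 r^2 = R0^2 / 2], so [Q] lies in the closed
   ball of radius [R0]. That ball is a compact part of [Omega] because [R0^2 = e / 4 < e], and [phi]
   is integrable on it. *)
pose R0 := Num.sqrt e / 2; pose r := R0 / 2.
have R00 : 0 < R0 by rewrite divr_gt0// sqrtr_gt0.
have r0 : 0 < r by rewrite divr_gt0.
have R0e : R0 ^+ 2 < e.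
  have -> : R0 ^+ 2 = Num.sqrt e ^+ 2 / 4 by rewrite /R0; field.
  by rewrite sqr_sqrtr ?(ltW e0)//; lra.
have rR0 : r ^+ 2 = R0 ^+ 2 / 4 by rewrite /r; field.
have R02 : 0 < R0 ^+ 2 by rewrite exprn_gt0.
move: eO; rewrite -(hsubmxK z0); move: (lsubmx z0) (rsubmx z0) => x0 y0 eO.
set z1 := row_mx x0 y0 in eO *.
set CB := closed_euclidean_ball z1 R0.
have CBO : CB `<=` Omega.
  move=> z; rewrite /CB closed_euclidean_ballE// => zR; apply: eO.
  exact: le_lt_trans R0e.
have mCB : measurable (CB : set (lebesgue_space R (m + n))).
  exact: closed_euclidean_ball_measurable.
set Bx := euclidean_ball x0 r; set By := euclidean_ball y0 r.
have mBx : measurable (Bx : set (lebesgue_space R m)).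
  exact: euclidean_ball_measurable.
have mBy : measurable (By : set (lebesgue_space R n)).
  exact: euclidean_ball_measurable.
set Q := row_setX Bx By.
have mQ2 : measurable ([set p | Q (row_mx p.1 p.2)] : set space2).
  rewrite (_ : [set p | _] = Bx `*` By); first exact: measurableX.
  by apply/seteqP; split=> p; rewrite /Q /row_setX /= row_mxKl row_mxKr.
have mQ : measurable (Q : set (lebesgue_space R (m + n))).
  have := @measurable_row_split R m n measurableT _ (measurableX mBx mBy).
  by rewrite setTI.
have QCB : Q `<=` CB.
  move=> z [] /=; rewrite /Bx /By /CB !euclidean_ballE// closed_euclidean_ballE//=.
  by rewrite -{3}(hsubmxK z) sqnorm_row_mxB rR0; lra.
have BQ : euclidean_ball z1 r `<=` Q.
  move=> z; rewrite /Q /row_setX /Bx /By !euclidean_ballE//=.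
  rewrite -{1}(hsubmxK z) sqnorm_row_mxB => h.
  have := sqnorm_ge0 (lsubmx z - x0); have := sqnorm_ge0 (rsubmx z - y0).
  by split; lra.
have QO z : Q z -> Omega z by move=> /QCB /CBO.
have CxO : closed_euclidean_ball x0 r `<=` x_section Omega y0.
  move=> x; rewrite closed_euclidean_ballE//= => xr; apply: CBO.
  by rewrite /CB closed_euclidean_ballE//= sqnorm_row_mxB subrr sqnorm0; lra.
have BxC : Bx `<=` closed_euclidean_ball x0 r.
  by rewrite /Bx euclidean_ballE// closed_euclidean_ballE// => x /ltW.
have BxO : Bx `<=` x_section Omega y0 by exact: subset_trans CxO.
exists r; split=> //; first by move=> z /BQ /QO.
pose up (z : 'rV[R]_(m + n)) : R := Num.max (u z) 0.
pose un (z : 'rV[R]_(m + n)) : R := Num.max (- u z) 0.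
have up0 z : 0 <= up z by rewrite /up le_max lexx orbT.
have un0 z : 0 <= un z by rewrite /un le_max lexx orbT.
have mu2Q : measurable_fun ([set p | Q (row_mx p.1 p.2)] : set space2)
    (fun p => u (row_mx p.1 p.2)).
  apply: (@measurable_funS _ _ _ _ ([set p | Omega (row_mx p.1 p.2)] : set space2)).
  - exact: measurable_setX_open.
  - by move=> p /QO.
  - exact: mu2.
pose upQ z := if z \in Q then up z else 0.
pose unQ z := if z \in Q then un z else 0.
have upQ1 z : Q z -> upQ z = up z by move=> zQ; rewrite /upQ mem_set.
have upQ0 z : ~ Q z -> upQ z = 0 by move=> zQ; rewrite /upQ memNset.
have unQ1 z : Q z -> unQ z = un z by move=> zQ; rewrite /unQ mem_set.
have unQ0 z : ~ Q z -> unQ z = 0 by move=> zQ; rewrite /unQ memNset.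
have mupQ : measurable_fun (setT : set space2) (fun p => (upQ (row_mx p.1 p.2))%:E).
  apply: (measurable_row_mx_extend0 (f := fun p => up (row_mx p.1 p.2)) mQ2).
  - by apply: measurable_maxr; [exact: mu2Q|exact: measurable_cst].
  - by move=> x y /upQ1.
  - exact: upQ0.
have munQ : measurable_fun (setT : set space2) (fun p => (unQ (row_mx p.1 p.2))%:E).
  apply: (measurable_row_mx_extend0 (f := fun p => un (row_mx p.1 p.2)) mQ2).
  - by apply: measurable_maxr; [exact: measurableT_comp mu2Q|exact: measurable_cst].
  - by move=> x y /unQ1.
  - exact: unQ0.
have upQp z : (0 <= (upQ z)%:E)%E by rewrite lee_fin /upQ; case: ifP.
have unQp z : (0 <= (unQ z)%:E)%E by rewrite lee_fin /unQ; case: ifP.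
pose A x := if x \in Bx then up (row_mx x y0) else 0.
have A1 x : Bx x -> A x = up (row_mx x y0) by move=> xB; rewrite /A mem_set.
have A0 x : ~ Bx x -> A x = 0 by move=> xB; rewrite /A memNset.
have Ap x : (0 <= (A x)%:E)%E by rewrite lee_fin /A; case: ifP.
have mA : measurable_fun setT (fun x : lebesgue_space R m => (A x)%:E).
  have mup : measurable_fun (Bx : set (lebesgue_space R m))
      ((fun x => up (row_mx x y0)) : lebesgue_space R m -> R).
    apply: measurable_maxr; last exact: measurable_cst.
    exact: mux_sub.
  by apply/measurable_EFinP; exact: (measurable_fun_extend0 mBx mup A1 A0).
have ByE : lam R n By = (unit_ball_volume R n * r ^+ n)%:E.
  exact: euclidean_ball_volume.
have By0 : (0 <= lam R n By)%E by exact: measure_ge0.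
(* On each slice, [u^+ = u + u^-] and the mean value property of [u(x, .)]. *)
have inner x : (\int[lam R n]_y (upQ (row_mx x y))%:E <=
    lam R n By * (A x)%:E + \int[lam R n]_y (unQ (row_mx x y))%:E)%E.
  have [xB|xB] := pselect (Bx x); last first.
    rewrite integral0_eq.
      by rewrite adde_ge0// ?mule_ge0// integral_ge0.
    by move=> y _; rewrite upQ0// /Q /row_setX /= row_mxKl => -[].
  rewrite (integral_extend0 (lam R n) (B := By) (f := fun y => up (row_mx x y))); last 2 first.
  - by move=> y yB; apply: upQ1; rewrite /Q /row_setX /= row_mxKl row_mxKr.
  - by move=> y yB; apply: upQ0; rewrite /Q /row_setX /= row_mxKl row_mxKr => -[].
  rewrite (integral_extend0 (lam R n) (B := By) (f := fun y => un (row_mx x y))); last 2 first.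
  - by move=> y yB; apply: unQ1; rewrite /Q /row_setX /= row_mxKl row_mxKr.
  - by move=> y yB; apply: unQ0; rewrite /Q /row_setX /= row_mxKl row_mxKr => -[].
  have CyO : closed_euclidean_ball y0 r `<=` y_section Omega x.
    move=> y; rewrite closed_euclidean_ballE//= => yr; apply: CBO.
    rewrite /CB closed_euclidean_ballE//= sqnorm_row_mxB.
    move: xB; rewrite /Bx euclidean_ballE//=; lra.
  have [inth hE] := harmonic_mean_value (open_y_section (x := x) oO) (hb x) r0 CyO.
  have mux_By : measurable_fun (By : set (lebesgue_space R n))
      ((fun y => u (row_mx x y)) : lebesgue_space R n -> R).
    by apply/measurable_EFinP; exact: measurable_int inth.
  (* On each slice [u^-] is integrable because [u] is, so the integral of [u + u^-] can be split
     without meeting a difference of infinities. *)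
  have intn : (lam R n).-integrable By (EFin \o (fun y => un (row_mx x y))).
    apply: le_integrable inth; first exact: mBy.
      apply/measurable_EFinP; apply: measurable_maxr; last exact: measurable_cst.
      exact: measurableT_comp mux_By.
    move=> y _ /=; rewrite lee_fin ger0_norm// /un ge_max normr_ge0 andbT.
    by rewrite -normrN ler_norm.
  rewrite (_ : (fun y => (up _)%:E) = fun y =>
    ((EFin \o (fun y => u (row_mx x y))) y + (EFin \o (fun y => un (row_mx x y))) y)%E).
    rewrite integralD// hE A1// muleC; apply: leeD => //.
    by apply: lee_wpmul2l => //; rewrite lee_fin /up le_max lexx.
  apply/funext => y; rewrite /= -EFinD /up /un; congr (_%:E).
  exact: max0_decomp.
(* With [y0] fixed this is the local integrability of [u^+] contained in (a), on a closed ball of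
   the section. *)
have Afin : (\int[lam R m]_x (A x)%:E < +oo)%E.
  have [_ _ [_ L1] _] := ha y0.
  have mCx := @closed_euclidean_ball_measurable R m x0 r r0.
  have pE : (fun x => `| ((fun x => (u (row_mx x y0))%:E) ^\+)%E x|%E) =
      (fun x => (up (row_mx x y0))%:E).
    apply/funext => x; rewrite funeposE gee0_abs; first by rewrite -EFin_max.
    by rewrite le_max lexx orbT.
  rewrite (integral_extend0 (lam R m) A1 A0).
  have := L1 _ (compact_closed_euclidean_ball (x := x0) r0) CxO.
  rewrite pE; apply: le_lt_trans; apply: ge0_subset_integral.
  - exact: mBx.
  - exact: mCx.
  - apply/measurable_EFinP; apply: measurable_maxr; last exact: measurable_cst.
    exact: mux_sub.
  - by move=> x _; rewrite lee_fin.
  - exact: BxC.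
have mO : measurable (Omega : set (lebesgue_space R (m + n))).
  exact: lebesgue_measurable_open.
have muO : measurable_fun (Omega : set (lebesgue_space R (m + n)))
    (u : lebesgue_space R (m + n) -> R).
  by apply/measurable_EFinP; exact: separately_harmonic_measurable.
have muQ : measurable_fun (Q : set (lebesgue_space R (m + n)))
    (u : lebesgue_space R (m + n) -> R).
  exact: measurable_funS muO.
(* The bound by [phi] is used on all of [Q] at once, since [phi] may fail to be integrable on an
   individual slice. *)
have unfin : (\int[lam R (m + n)]_z (unQ z)%:E < +oo)%E.
  have mphi : measurable_fun (CB : set (lebesgue_space R (m + n)))
      (fun z => `|phi z|%E : \bar R).
    by apply: measurableT_comp => //; exact: measurable_funS phiL.1.
  rewrite (integral_extend0 (lam R (m + n)) unQ1 unQ0).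
  apply: le_lt_trans (phiL.2 CB (compact_closed_euclidean_ball (x := z1) R00) CBO).
  apply: (@le_trans _ _ (\int[lam R (m + n)]_(z in Q) `|phi z|)%E).
    apply: ge0_le_integral.
    - exact: mQ.
    - by move=> z _; rewrite lee_fin.
    - apply/measurable_EFinP; apply: measurable_maxr; last exact: measurable_cst.
      exact: measurableT_comp muQ.
    - exact: measurable_funS mphi.
    - move=> z /QO zO; rewrite gee0_abs ?phi0// /un EFin_max ge_max phi0// andbT.
      by rewrite EFinN leeNl phiu.
  by apply: ge0_subset_integral.
apply: (@le_lt_trans _ _ (\int[lam R (m + n)]_z (upQ z)%:E)%E).
  rewrite (integral_extend0 (lam R (m + n)) upQ1 upQ0).
  apply: ge0_subset_integral.
  - exact: euclidean_ball_measurable.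
  - exact: mQ.
  - by apply/measurable_EFinP; apply: measurable_maxr; [exact: muQ|exact: measurable_cst].
  - by move=> z _; rewrite lee_fin; exact: up0.
  - exact: BQ.
rewrite (integral_row_mx mupQ)//.
have mF : measurable_fun setT
    (fun x : lebesgue_space R m => (\int[lam R n]_y (unQ (row_mx x y))%:E)%E).
  exact: (measurable_fun_fubini_tonelli_F (m2 := lam R n) _ munQ).
have mBA : measurable_fun setT (fun x : lebesgue_space R m => (lam R n By * (A x)%:E)%E).
  by apply: emeasurable_funM; [exact: measurable_cst|exact: mA].
apply: (@le_lt_trans _ _ (\int[lam R m]_x (lam R n By * (A x)%:E +
    \int[lam R n]_y (unQ (row_mx x y))%:E))%E).
  apply: ge0_le_integral.
  - exact: measurableT.
  - by move=> x _; apply: integral_ge0.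
  - exact: (measurable_fun_fubini_tonelli_F (m2 := lam R n) _ mupQ).
  - exact: emeasurable_funD mBA mF.
  - by move=> x _; exact: inner.
rewrite (ge0_integralD _ measurableT _ mBA _ mF); last 2 first.
- by move=> x _; rewrite mule_ge0.
- by move=> x _; apply: integral_ge0.
rewrite (ge0_integralZl _ measurableT mA)//.
rewrite (integral_row_mx munQ unQp) in unfin.
apply: lte_add_pinfty; last exact: unfin.
by rewrite ByE; apply: lte_mul_pinfty => //; rewrite -ByE.
Qed.

(** A compact set is covered by finitely many of the balls on which [u^+] has finite integral. *)
Lemma separately_harmonic_L1loc : L1loc Omega (fun z => (u z)%:E)^\+%E.
Proof.
have mO : measurable (Omega : set (lebesgue_space R (m + n))).
  exact: lebesgue_measurable_open.
have mu := separately_harmonic_measurable.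
split=> [|C cC CO]; first exact: measurable_funepos.
pose up (z : 'rV[R]_(m + n)) : \bar R := (Num.max (u z) 0)%:E.
have up0 z : (0 <= up z)%E by rewrite lee_fin le_max lexx orbT.
have mup (A : set (lebesgue_space R (m + n))) : A `<=` Omega -> measurable_fun A up.
  move=> AO; apply: (measurable_funS mO AO).
  apply/measurable_EFinP; apply: measurable_maxr; last exact: measurable_cst.
  exact/measurable_EFinP.
rewrite (_ : (fun z => `| _ |%E) = up); last first.
  apply/funext => z; rewrite funeposE gee0_abs; first by rewrite /up EFin_max.
  by rewrite le_max lexx orbT.
have /choice[r rP] : forall z, exists r : R, Omega z -> [/\ 0 < r,
    euclidean_ball z r `<=` Omega &
    (\int[lam R (m + n)]_(z in euclidean_ball z r) (Num.max (u z) 0)%:E < +oo)%E].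
  move=> z; have [Oz|Oz] := pselect (Omega z); last by exists 0.
  by have [r rP] := separately_harmonic_locally_finite Oz; exists r.
have : cover_compact C by rewrite -compact_cover.
move=> /(_ _ Omega (fun z => euclidean_ball z (r z))) [].
- by move=> z /rP[r0 _ _]; exact: open_euclidean_ball.
- move=> z /CO Oz; exists z => //; have [r0 _ _] := rP z Oz.
  by rewrite euclidean_ballE//= subrr sqnorm0 exprn_gt0.
move=> D' D'O CD'.
(* The induction carries a single measurable set of finite integral that contains the balls treated
   so far, so each step only joins two sets. *)
have finA (s : seq 'rV[R]_(m + n)) : (forall z, z \in s -> Omega z) ->
    exists A : set (lebesgue_space R (m + n)), [/\ measurable A, A `<=` Omega,
     (forall z, z \in s -> euclidean_ball z (r z) `<=` A) &
     (\int[lam R (m + n)]_(z in A) up z < +oo)%E].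
  elim: s => [_|z s IHs sO].
    exists set0; split; [exact: measurable0|by []|by []|].
    by rewrite integral_set0 ltry.
  have [|A [mA AO Acov Afin]] := IHs.
    by move=> y ys; apply: sO; rewrite inE ys orbT.
  have [r0 zO zfin] := rP z (sO z (mem_head _ _)).
  have mz := euclidean_ball_measurable z r0.
  have AzO : A `|` euclidean_ball z (r z) `<=` Omega by move=> y [/AO|/zO].
  exists (A `|` euclidean_ball z (r z)); split.
  - exact: measurableU.
  - exact: AzO.
  - by move=> y; rewrite inE => /predU1P[-> w|/Acov yA w /yA]; [right|left].
  - apply: ge0_integral_setU_lty => //; exact: mup.
have [A [mA AO Acov Afin]] := finA _ (fun z zD => set_mem (D'O z zD)).
have mC : measurable (C : set (lebesgue_space R (m + n))).
  apply: lebesgue_measurable_closed; exact: compact_closed.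
apply: le_lt_trans Afin; apply: ge0_subset_integral.
- exact: mC.
- exact: mA.
- exact: mup.
- by move=> z _; exact: up0.
- move=> z /CD' [y yD' zy]; exact: Acov zy.
Qed.

End separately_harmonic.

Theorem theorem1 (R : realType) (m n : nat) (hm : (2 <= m)%N) (hn : (2 <= n)%N)
    (Omega : set 'rV[R]_(m + n)) (hOmega : domain Omega)
    (K : R) (hK : 1 <= K) (u : 'rV[R]_(m + n) -> R)
    (ha : forall y : 'rV[R]_n,
       quasinearly_subharmonic K (x_section Omega y)
         (fun x : 'rV[R]_m => (u (row_mx x y))%:E))
    (hb : forall x : 'rV[R]_m,
       harmonic_on (y_section Omega x) (fun y : 'rV[R]_n => u (row_mx x y)))
    (hc : exists phi : 'rV[R]_(m + n) -> \bar R,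
       [/\ L1loc Omega phi,
           forall z, Omega z -> (0 <= phi z)%E
         & forall z, Omega z -> (- phi z <= (u z)%:E)%E]) :
  quasinearly_subharmonic K Omega (fun z => (u z)%:E).
Proof.
have [oO _ _] := hOmega; have [phi [phiL phi0 phiu]] := hc.
split=> [z _||| M z r M0 r0 zO]; first exact: ltry.
- exact (separately_harmonic_measurable oO ha hb).
- exact (separately_harmonic_L1loc oO ha hb phiL phi0 phiu).
have b0 : 0 < unit_ball_volume R (m + n) * r ^+ (m + n).
  by rewrite mulr_gt0 ?exprn_gt0 ?unit_ball_volume_gt0.
have := separately_harmonic_mean_le oO ha hb (lt_le_trans ltr01 hK) M0 r0 zO.
rewrite [X in (_ * X <= _)%E](_ : _ = (unit_ball_volume R (m + n) * r ^+ (m + n))%:E).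
  rewrite truncationE (_ : truncation _ M = fun z => (Num.max (u z) (- M) + M)%:E).
    by rewrite muleC -lee_pdivlMl// muleA -EFinM mulrC.
  by apply/funext => y; exact: truncationE.
exact: euclidean_ball_volume.
Qed.
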